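(* Let $d$ be a projectively flat asymmetric metric on a convex domain $\Omega\subset\mathbb{R}^n$. Then $d$ is induced by a pseudo-norm function $F$ satisfying the Lipschitz condition $$\text{for every }x\in\Omega\text{ there exist a neighbourhood }U(x)\text{ of }x\text{ and }C=C(x)>0\text{ with } |F(x_1,y)-F(x_2,y)|\le C|y||x_1-x_2|\ \ \forall x_1,x_2\in U(x),\ \forall y\in\mathbb{R}^n$$ if and only if, for every $x\in\Omega$, there exist positive constants $r=r(x)$, $c=c(x)$ and $C=C(x)$ such that $$c|x_2-x_1|\le d(x_1,x_2)\le C|x_2-x_1|,\qquad |d(x_1,x_1+y)-d(x_2,x_2+y)|\le C|y||x_2-x_1|$$ for all $x_1,x_2,x_1+y,x_2+y\in\mathbb{B}^n_r(x)$. In this case, $F$ is also projectively flat. Moreover, $d$ is smooth if and only if $F$ is smooth.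
   Context: $|\cdot|$ is the Euclidean norm and $\mathbb{B}^n_r(x)$ the open Euclidean ball. $T\Omega$ is identified with $\Omega\times\mathbb{R}^n$. An asymmetric metric on $\Omega$ is a continuous function $d:\Omega\times\Omega\to[0,+\infty)$ such that for all $x_1,x_2,x_3\in\Omega$: $d(x_1,x_2)\ge0$ with equality iff $x_1=x_2$; and $d(x_1,x_3)\le d(x_1,x_2)+d(x_2,x_3)$. It is smooth if it is $C^\infty$ on $(\Omega\times\Omega)\setminus\{(x,y):x=y\}$. For a continuous curve $\gamma:[0,1]\to\Omega$, $L_d(\gamma)=\sup\{\sum_{i=1}^Nd(\gamma(t_{i-1}),\gamma(t_i)):N\in\mathbb N,\ 0=t_0<\dots<t_N=1\}$. $d$ is projectively flat if the minimizing curve between two points is a straight line segment, that is, $d(x_1,x_2)=L_d(\gamma)$ where $\gamma$ is the straight segment from $x_1$ to $x_2$, for all $x_1,x_2\in\Omega$. A pseudo-norm function is a continuous function $F:T\Omega\to[0,+\infty)$ such that for every $x$ the function $F(x,\cdot)$ is a pseudo-norm: nonnegative and zero only at $y=\mathbf 0$, $F(x,\alpha y)=\alpha F(x,y)$ for $\alpha>0$, and $F(x,y_1+y_2)\le F(x,y_1)+F(x,y_2)$. It is smooth if $F\in C^\infty(T\Omega\setminus\{0\})$. It induces $d_F(x_1,x_2)=\inf\int_0^1F(c(t),c'(t))\,dt$, the infimum over piecewise smooth curves $c:[0,1]\to\Omega$ from $x_1$ to $x_2$; ''$d$ is induced by $F$'' means $d=d_F$. $F$ is projectively flat if $d_F$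 is. *)

(* Defs.v *)
From mathcomp Require Export all_boot all_order all_algebra.
From mathcomp Require Export all_classical all_reals all_analysis.
Export numFieldNormedType.Exports.
Export Order.TTheory GRing.Theory Num.Theory.

Set Implicit Arguments.
Unset Strict Implicit.
Unset Printing Implicit Defensive.

Local Open Scope classical_set_scope.
Local Open Scope ring_scope.

(* Metrics on Omega and functions on T Omega = Omega x R^n are encoded as total
   functions 'rV[R]_n -> 'rV[R]_n -> R; every definition below only depends on
   the values d x1 x2 with x1, x2 in Omega, resp. F x y with x in Omega. *)

(* The library norm of 'rV[R]_n is the sup norm, hence the explicit Euclidean
   norm. Both induce the same topology, so the library's notions of
   continuity, neighbourhood and derivative apply unchanged. *)
Definition enorm {R : realType} {n : nat} (x : 'rV[R]_n) : R :=
  Num.sqrt (\sum_(i < n) x 0 i ^+ 2).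

Definition eball {R : realType} {n : nat} (x : 'rV[R]_n) (r : R) :
    set 'rV[R]_n :=
  [set z | enorm (z - x) < r].

(* Connectedness follows from convexity. *)
Definition convex_domain {R : realType} {n : nat} (Omega : set 'rV[R]_n) :=
  [/\ open Omega, Omega !=set0
    & convex_set (Omega : set (convex_lmodType 'rV[R]_n))].

Section Smoothness.
Context {R : realType} {V W : normedModType R}.

(* f is of class C^k on the open set A: all its iterated directional
   derivatives up to order k exist and are continuous on A (in finite dimension
   this is the usual condition on partial derivatives). Derivatives at points
   of A only depend on f near these points because A is open. *)
Fixpoint Ck_on (k : nat) (A : set V) (f : V -> W) : Prop :=
  (forall x, A x -> {for x, continuous f}) /\
  match k with
  | 0 => True
  | k'.+1 => forall v : V,
      (forall x, A x -> derivable f x v) /\ Ck_on k' A ('D_v f)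
  end.

Definition smooth_on (A : set V) (f : V -> W) : Prop :=
  forall k, Ck_on k A f.

Definition smooth_curve (g : R -> W) : Prop :=
  forall k t, derivable (derive1n k g) t 1.

(* On each closed subinterval of some partition of [0, 1] the curve coincides
   with the restriction of a C^oo curve defined on the whole line (that is, it
   is C^oo up to the endpoints); in particular c is continuous on [0, 1]. *)
Definition piecewise_smooth (c : R -> W) : Prop :=
  exists2 s : seq R, itv_partition 0 1 s &
    forall i, (i < size s)%N ->
      exists2 g : R -> W, smooth_curve g &
        forall t, nth 1 (0 :: s) i <= t <= nth 1 (0 :: s) i.+1 -> c t = g t.

End Smoothness.

Section Metrics.
Context {R : realType} {n : nat}.
Local Notation V := 'rV[R]_n.
Implicit Types (Omega : set V) (d F : V -> V -> R).

Record asymmetric_metric Omega d : Prop := {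
  am_continuous : {within Omega `*` Omega, continuous (fun p => d p.1 p.2)};
  am_ge0 : forall x1 x2, Omega x1 -> Omega x2 -> 0 <= d x1 x2;
  am_eq0 : forall x1 x2, Omega x1 -> Omega x2 -> (d x1 x2 = 0 <-> x1 = x2);
  am_triangle : forall x1 x2 x3, Omega x1 -> Omega x2 -> Omega x3 ->
    d x1 x3 <= d x1 x2 + d x2 x3
}.

Definition smooth_metric Omega d : Prop :=
  smooth_on [set p | [/\ Omega p.1, Omega p.2 & p.1 <> p.2]]
            (fun p => d p.1 p.2 : R^o).

(* A partition 0 = t_0 < t_1 < ... < t_N = 1 is encoded by the sequence
   s = [:: t_1; ...; t_N]. *)
Definition metric_length d (gamma : R -> V) : \bar R :=
  ereal_sup [set (\sum_(i < size s)
                    d (gamma (nth 1 (0 :: s) i))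
                      (gamma (nth 1 (0 :: s) i.+1)))%:E
            | s in [set s : seq R | itv_partition 0 1 s]].

Definition segment (x1 x2 : V) : R -> V := fun t => x1 + t *: (x2 - x1).

Definition projectively_flat Omega d : Prop :=
  forall x1 x2, Omega x1 -> Omega x2 ->
    (d x1 x2)%:E = metric_length d (segment x1 x2).

Record pseudo_norm (f : V -> R) : Prop := {
  pn_ge0 : forall y, 0 <= f y;
  pn_eq0 : forall y, f y = 0 <-> y = 0;
  pn_homog : forall a y, 0 < a -> f (a *: y) = a * f y;
  pn_subadd : forall y1 y2, f (y1 + y2) <= f y1 + f y2
}.

Record pseudo_norm_function Omega F : Prop := {
  pnf_continuous : {within Omega `*` setT, continuous (fun p => F p.1 p.2)};
  pnf_pseudo_norm : forall x, Omega x -> pseudo_norm (F x)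
}.

Definition smooth_pseudo_norm_function Omega F : Prop :=
  smooth_on [set p | Omega p.1 /\ p.2 <> 0] (fun p => F p.1 p.2 : R^o).

Record admissible_curve Omega (x1 x2 : V) (c : R -> V) : Prop := {
  ac_smooth : piecewise_smooth c;
  ac_sub : forall t, 0 <= t <= 1 -> Omega (c t);
  ac_start : c 0 = x1;
  ac_end : c 1 = x2
}.

(* Derivatives at the finitely many break points and at 0 and 1, where they
   may fail to exist, do not affect the integral. The infimum is taken in R:
   for F >= 0 the set is bounded below by 0, and it is nonempty when Omega is
   convex. *)
Definition induced_metric Omega F (x1 x2 : V) : R :=
  inf [set (\int[lebesgue_measure]_(t in `[0, 1]) F (c t) (derive1 c t))%R
      | c in admissible_curve Omega x1 x2].

Definition induced_by Omega d F : Prop :=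
  forall x1 x2, Omega x1 -> Omega x2 -> d x1 x2 = induced_metric Omega F x1 x2.

Definition lipschitz_pseudo_norm_function Omega F : Prop :=
  forall x, Omega x ->
    exists (U : set V) (C : R),
      [/\ nbhs x U, U `<=` Omega, 0 < C
        & forall x1 x2 y, U x1 -> U x2 ->
            `|F x1 y - F x2 y| <= C * enorm y * enorm (x1 - x2)].

Definition locally_euclidean_bounds Omega d : Prop :=
  forall x, Omega x ->
    exists r c C : R,
      [/\ 0 < r, 0 < c, 0 < C, eball x r `<=` Omega
        & forall x1 x2 y, eball x r x1 -> eball x r x2 ->
            eball x r (x1 + y) -> eball x r (x2 + y) ->
            (c * enorm (x2 - x1) <= d x1 x2 <= C * enorm (x2 - x1)) /\
            `|d x1 (x1 + y) - d x2 (x2 + y)| <= C * enorm y * enorm (x2 - x1)].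

End Metrics.

(* Main.v *)
Require Import Defs.
From mathcomp Require Import ring lra measurable_realfun.

(* Being projectively flat, d is additive along segments. If d has the local
   Euclidean bounds, the quotients d(x, x + t y) / t therefore converge as
   t -> 0+, and F x y is their limit. Conversely, if d is induced by a
   locally Lipschitz F, then F is this directional derivative of d: compare d
   from above with the segment, and from below with the norm F(x, .) frozen at
   x. In both situations a comparison of right derivatives gives
   d(x1, x2) <= int F(c, c') along every curve c, with equality on the segment
   by additivity, that is
   d(x1, x2) = int_0^1 F(x1 + t (x2 - x1), x2 - x1) dt.
   This formula yields the Lipschitz bound of d, and smoothness of d by
   differentiation under the integral sign. Additivity also gives
   F x y = D_(0, y) d (x - e y, x), a derivative taken off the diagonal, so F
   is smooth when d is. *)

Set Implicit Arguments.
Unset Strict Implicit.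
Unset Printing Implicit Defensive.
Local Open Scope classical_set_scope.
Local Open Scope ring_scope.

(** Additivity along segments does not by itself make the quotients d(x, x + t y) / t converge. The
    Lipschitz bound for translates does: the two halves of the segment from x to x + y are
    translates of each other by y / 2, so their lengths differ by at most C |y|^2 / 4. Halving
    repeatedly and telescoping gives convergence along t = 2^-k with an error quadratic in y, and
    such an error at every small vector upgrades the dyadic limit to a limit over all t -> 0+. In
    the converse direction, freezing F at x costs a relative error O(s) on a region of size O(s)
    around x, hence O(s^2) for the vector s v. Curves that leave this region are the obstacle, and a
    truncated comparison function takes care of them. Finally, C^k is stated through derivatives in
    fixed directions; linearity of the derivative in its direction has to be earned from
    continuity. *)

Lemma near_at_right {R : realType} (x : R) (P : set R) :
  (\forall s \near x, P s) -> \forall s \near x^'+, P s.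
Proof. by apply: cvg_within. Qed.

(** At h = 0 the quotient-free estimate is trivial, so it holds on a full neighbourhood of 0.
    Estimates in this form add up and restrict to h > 0 without dividing. *)
Lemma is_derive_epsP {R : realType} {V W : normedModType R} (f : V -> W) a v l :
  is_derive a v f l <-> forall e, 0 < e ->
    \forall h \near (0 : R), `|f (a + h *: v) - f a - h *: l| <= e * `|h|.
Proof.
have quotE (h : R) e : h != 0 ->
    (`|l - h^-1 *: (f (h *: v + a) - f a)| <= e) =
    (`|f (a + h *: v) - f a - h *: l| <= e * `|h|).
  move=> h0.
  have -> : f (a + h *: v) - f a - h *: l =
      - (h *: (l - h^-1 *: (f (h *: v + a) - f a))).
    by rewrite scalerBr scalerKV// opprB [a + _]addrC.
  by rewrite normrN normrZ mulrC ler_pM2r ?normr_gt0.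
split=> [[df fE] e e0|fl].
  have /cvgrPdist_le/(_ e e0) : h^-1 *: (f (h *: v + a) - f a) @[h --> 0^'] --> l.
    by rewrite -fE; exact: df.
  rewrite near_withinE; apply: filterS => h hl.
  have [->|h0] := eqVneq h 0; last by rewrite -quotE//; exact: hl.
  by rewrite !scale0r addr0 subrr subr0 !normr0 mulr0.
suff cl : h^-1 *: (f (h *: v + a) - f a) @[h --> 0^'] --> l.
  by split; [exact: cvgP cl | exact: cvg_lim cl].
apply/cvgrPdist_le => e e0; rewrite near_withinE.
by have := fl e e0; apply: filterS => h hl h0; rewrite quotE.
Qed.

(** * Comparison of right growth rates on an interval *)

Section RealLine.
Context {R : realType}.
Local Notation mu := (@lebesgue_measure R).
Implicit Types (f k : R -> R) (a b : R).

(** The supremum [c] of the times where the bound holds satisfies it by continuity; if c < b, right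
    growth at [c] would produce a later such time. *)
Lemma dini_le_closed f a b e : a <= b -> 0 < e ->
  {within `[a, b], continuous f} ->
  (forall t, a <= t < b -> \forall s \near 0^'+, f (t + s) - f t <= e * s) ->
  f b - f a <= e * (b - a).
Proof.
move=> ab e0 cf df.
pose S := [set t | a <= t <= b /\ f t - f a <= e * (t - a)].
have Sa : S a by split; rewrite ?lexx ?ab // !subrr mulr0.
have supS : has_sup S.
  by split; [exists a | exists b => t [/andP[]]].
set c := sup S.
have ac : a <= c by exact: sup_upper_bound.
have cb : c <= b by apply: ge_sup; [exists a | move=> t [/andP[]]].
(* If the bound failed at [c], it would fail near [c], yet points of [S] come arbitrarily close to
   [c]. *)
have Sc : S c.
  split; rewrite ?ac // leNgt; apply/negP => fc.
  have /subspace_continuousP/(_ c) := cf.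
  rewrite /= in_itv /= ac cb => /(_ isT) cfc.
  pose h t := f t - f a - e * (t - a).
  have ch : h t @[t --> within `[a, b] (nbhs c)] --> h c.
    apply: cvgB; first by apply: cvgB => //; exact: cvg_cst.
    apply: cvgM; first exact: cvg_cst.
    apply: cvgB; last exact: cvg_cst.
    by apply: cvg_within.
  have : \forall t \near within `[a, b] (nbhs c), 0 < h t.
    by apply: cvgr_gt ch _ _; rewrite subr_gt0.
  rewrite near_withinE => /nbhs_ballP[r /= r0 hr].
  have [t St ct] := sup_adherent r0 supS.
  have tc : t <= c by exact: sup_upper_bound.
  have /hr : ball c r t.
    by rewrite /ball /= ger0_norm ?subr_ge0// ltrBlDr -ltrBlDl.
  case: St => tab ft /(_ _); rewrite /= in_itv /= tab => /(_ isT).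
  by rewrite /h subr_gt0 ltNge ft.
have [<-|cb'] := eqVneq c b; first by case: Sc.
have {cb'}cltb : c < b by rewrite lt_neqAle cb'.
have := df c; rewrite ac cltb => /(_ isT) dfc.
have [s [s0 sb fs]] : exists s, [/\ 0 < s, s <= b - c & f (c + s) - f c <= e * s].
  near (0:R)^'+ => s; exists s; split=> //; last by near: s.
  near: s; apply: nbhs_right_le; by rewrite subr_gt0.
have : S (c + s).
  split; first by rewrite (le_trans ac) ?lerDl ?(ltW s0)//= -lerBrDl.
  case: Sc => _ fc.
  have -> : f (c + s) - f a = (f (c + s) - f c) + (f c - f a) by ring.
  have -> : e * (c + s - a) = e * s + e * (c - a) by ring.
  exact: lerD.
move=> /(sup_upper_bound supS); rewrite -/c => /le_trans/(_ (lexx _)).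
by rewrite gerDl leNgt s0.
Unshelve. all: by end_near. Qed.

(** Growth is controlled only inside ]a, b[, so the bound is proved from each t > a, with slope e /
    (b - t) so that the total increase is [e]. Continuity at [a] then lets t tend to [a]. *)
Lemma dini_le f a b : a <= b -> {within `[a, b], continuous f} ->
  (forall t e, a < t < b -> 0 < e ->
    \forall s \near 0^'+, f (t + s) - f t <= e * s) ->
  f b <= f a.
Proof.
rewrite le_eqVlt => /predU1P[-> //|ab] cf df.
have cfa : f x @[x --> a^'+] --> f a.
  by have /(continuous_within_itvP _ ab)[] := cf.
have fb t : a < t < b -> f b <= f t.
  move=> /andP[at_ tb]; apply/ler_addgt0Pl => e e0.
  rewrite -lerBlDr.
  have e1 : 0 < e / (b - t) by rewrite divr_gt0 // subr_gt0.
  have -> : e = (e / (b - t)) * (b - t) by rewrite divfK// subr_eq0 gt_eqF.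
  apply: dini_le_closed => //; first exact: ltW.
    apply: continuous_subspaceW cf; apply: subset_itvr => //.
    by rewrite bnd_simp ltW.
  move=> u /andP[tu ub]; apply: df => //.
  by rewrite ub (lt_le_trans at_ tu).
apply: (cvgr_to_ge cfa); near=> t; apply: fb; apply/andP; split => //.
Unshelve. all: by end_near. Qed.

Lemma continuous_itv_integrable k a b :
  (forall t, a <= t <= b -> {for t, continuous k}) ->
  mu.-integrable `[a, b] (EFin \o k).
Proof.
move=> ck; apply: continuous_compact_integrable; first exact: segment_compact.
apply: continuous_in_subspaceT => t /set_mem /=; rewrite in_itv /=; exact: ck.
Qed.

(** [f] minus the primitive of [k] is nonincreasing by [dini_le]; the error [e] is shared equally
    between the growth of [f] and the derivative of the primitive. *)
Lemma growth_le_integral f k a b : a <= b ->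
  {within `[a, b], continuous f} ->
  (forall t, a <= t <= b -> {for t, continuous k}) ->
  (forall t e, a < t < b -> 0 < e ->
    \forall s \near 0^'+, f (t + s) - f t <= s * (k t + e)) ->
  f b - f a <= \int[mu]_(t in `[a, b]) k t.
Proof.
move=> ab cf ck fk.
have ik := continuous_itv_integrable ck.
pose K t := \int[mu]_(u in `[a, t]) k u.
suff : f b - K b <= f a - K a.
  by rewrite /K set_itv1 Rintegral_set1 subr0 lerBlDr lerBlDl.
apply: (@dini_le (fun t => f t - K t)) => //.
  move=> t; apply: cvgB; first exact: cf.
  exact: (parameterized_integral_continuous ab ik).
move=> t e /andP[at_ tb] e0.
have ct : {for t, continuous k} by apply: ck; rewrite !ltW.
have [dK KE] := continuous_FTC1_closed tb ik at_ ct.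
have {KE dK} : \forall s \near 0^'+, s * (k t - e / 2) <= K (t + s) - K t.
  have /is_derive_epsP : is_derive t 1 K (k t).
    by apply: DeriveDef; [exact: dK | rewrite -derive1E; exact: KE].
  move=> /(_ (e / 2)) /(_ (divr_gt0 e0 (ltr0n _ 2))) /near_at_right KE'.
  near=> s; have s0 : 0 < s by [].
  have : `|K (t + s *: 1) - K t - s *: k t| <= e / 2 * `|s|.
    by near: s.
  rewrite (gtr0_norm s0) ler_norml => /andP[+ _].
  rewrite /GRing.scale /= mulr1; lra.
have e2 : 0 < e / 2 by rewrite divr_gt0.
move=> HK.
near=> s.
have fs : f (t + s) - f t <= s * (k t + e / 2).
  by near: s; apply: fk => //; rewrite at_.
have Ks : s * (k t - e / 2) <= K (t + s) - K t by near: s.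
have -> : e * s = s * (k t + e / 2) - s * (k t - e / 2) by field.
have -> : f (t + s) - K (t + s) - (f t - K t) =
   (f (t + s) - f t) - (K (t + s) - K t) by ring.
exact: lerB.
Unshelve. all: by end_near. 
Qed.
End RealLine.

(** * Growth along curves *)

Section IntervalIntegral.
Context {R : realType}.
Local Notation mu := (@lebesgue_measure R).
Implicit Types (f k : R -> R) (a b c : R).

Lemma integrable_itv_oo_cc f a b :
  mu.-integrable `]a, b[ (EFin \o f) -> mu.-integrable `[a, b] (EFin \o f).
Proof.
move=> fi; have mf : measurable_fun `[a, b] f.
  apply/measurable_fun_itv_obnd_cbndP/measurable_fun_itv_bndo_bndcP.
  by apply/measurable_EFinP; exact: (measurable_int mu fi).
have mN : measurable ([set a] `|` [set b]) by exact: measurableU.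
have N0 : mu ([set a] `|` [set b]) = 0%E.
  rewrite measureU0//; exact: lebesgue_measure_set1.
have mEf : measurable_fun `[a, b] (EFin \o f) by exact/measurable_EFinP.
have [_ h] := @negligible_integrable _ _ _ mu _ _ _ mN (measurable_itv `[a, b]) mEf N0.
apply: h.
apply: integrableS fi => //.
  by apply: measurableD => //; exact: measurableU.
move=> x /= []; rewrite !in_itv /= => /andP[ax xb] /not_orP[/eqP xa /eqP xb'].
by rewrite !lt_neqAle ax xb xb' eq_sym xa.
Qed.

(** Made for [derive1 c]: on a smooth piece the curve agrees with a smooth [g], but at the two ends
    its derivative also depends on the neighbouring pieces and may be a junk value. *)
Lemma eq_integral_itv_oo f k a b :
  (forall t, a < t < b -> f t = k t) ->
  mu.-integrable `[a, b] (EFin \o k) ->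
  mu.-integrable `[a, b] (EFin \o f) /\
  \int[mu]_(t in `[a, b]) f t = \int[mu]_(t in `[a, b]) k t.
Proof.
move=> fk ki.
have koo : mu.-integrable `]a, b[ (EFin \o k).
  by apply: integrableS ki => //; exact: subset_itv_oo_cc.
have foo : mu.-integrable `]a, b[ (EFin \o f).
  apply: eq_integrable koo => // t; rewrite inE /= in_itv /= => tab.
  by rewrite fk.
have fi := integrable_itv_oo_cc foo; split=> //.
have oo h : mu.-integrable `[a, b] (EFin \o h) ->
    \int[mu]_(t in `[a, b]) h t = \int[mu]_(t in `]a, b[) h t.
  move=> hi; rewrite -Rintegral_itv_obnd_cbnd.
    rewrite -Rintegral_itv_bndo_bndc//.
    by apply: integrableS hi => //; exact: subset_itv_oo_cc.
  by apply: integrableS hi => //; exact: subset_itv_oc_cc.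
rewrite (oo f)// (oo k)//; apply: eq_Rintegral => t.
by rewrite inE /= in_itv /= => tab; rewrite fk.
Qed.

Lemma integral_itv_cat f a b c : a <= b -> b <= c ->
  mu.-integrable `[a, b] (EFin \o f) -> mu.-integrable `[b, c] (EFin \o f) ->
  mu.-integrable `[a, c] (EFin \o f) /\
  \int[mu]_(t in `[a, c]) f t =
    \int[mu]_(t in `[a, b]) f t + \int[mu]_(t in `[b, c]) f t.
Proof.
move=> ab bc fab fbc.
have fboc : mu.-integrable `]b, c] (EFin \o f).
  by apply: integrableS fbc => //; exact: subset_itv_oc_cc.
have acE : `[a, c]%classic = `[a, b]%classic `|` `]b, c]%classic :> set R.
  by rewrite -itv_bndbnd_setU ?bnd_simp.
have fac : mu.-integrable `[a, c] (EFin \o f).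
  have : mu.-integrable `[a, c]
      (((EFin \o f) \_ `[a, b]%classic) \+ ((EFin \o f) \_ `]b, c]%classic))%E.
    apply: integrableD => //.
      by apply/integrable_restrict => //; rewrite setIidr// acE; exact: subsetUl.
    by apply/integrable_restrict => //; rewrite setIidr// acE; exact: subsetUr.
  apply: eq_integrable => // t; rewrite inE acE /= /patch => tac.
  have [tab|tab] := boolP (t \in `[a, b]%classic).
    rewrite ifF ?adde0//; apply/negP; rewrite inE /= in_itv /= => /andP[bt _].
    move: tab; rewrite inE /= in_itv /= => /andP[_]; apply/negP; rewrite -ltNge; exact: bt.
  rewrite (_ : point = 0%E :> \bar R)// add0e ifT//; case: tac => [tab'|]; last by rewrite inE.
  by case/negP: tab; rewrite inE.
split=> //.
rewrite -[\int[mu]_(t in `[b, c]) _]Rintegral_itv_obnd_cbnd//.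
by rewrite -(@Rintegral_itvB _ f (BLeft a) _ b)// ?bnd_simp// addrC subrK.
Qed.

End IntervalIntegral.

Section CurveIntegral.
Context {R : realType} {n : nat}.
Local Notation V := 'rV[R]_n.
Local Notation mu := (@lebesgue_measure R).
Variables (Omega : set V) (F : V -> V -> R).
Hypothesis cF : forall x y, Omega x ->
  {for (x, y), continuous (fun p : V * V => F p.1 p.2)}.

Lemma derivable1_continuous (g : R -> V) t : derivable g t 1 -> {for t, continuous g}.
Proof. by move=> /derivable1_diffP/differentiable_continuous. Qed.

Lemma continuous_along (g h : R -> V) t : Omega (g t) ->
  {for t, continuous g} -> {for t, continuous h} ->
  {for t, continuous (fun u => F (g u) (h u))}.
Proof.
move=> Og cg ch.
by apply: continuous2_cvg cg ch; exact: cF.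
Qed.

Variable rho : V -> R.
Hypothesis crho : forall x, Omega x -> {for x, continuous rho}.
Hypothesis growth : forall x y e, Omega x -> 0 < e ->
  \forall s \near 0^'+ & w \near y, rho (x + s *: w) - rho x <= s * (F x y + e).

(** A curve satisfies g (t + s) = g t + s *: w s where the difference quotient [w s] only tends to
    the velocity. This is why [growth] is uniform over directions [w] near [y]. *)
Lemma smooth_piece_growth (c g : R -> V) a b : a <= b -> smooth_curve g ->
  (forall t, a <= t <= b -> c t = g t) ->
  (forall t, a <= t <= b -> Omega (c t)) ->
  mu.-integrable `[a, b] (EFin \o (fun t => F (c t) (derive1 c t))) /\
  rho (c b) - rho (c a) <= \int[mu]_(t in `[a, b]) F (c t) (derive1 c t).
Proof.
move=> ab sg cg Oc.
have Og t : a <= t <= b -> Omega (g t) by move=> tab; rewrite -cg//; exact: Oc.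
have dg t : derivable g t 1 by exact: (sg 0 t).
have contg t : {for t, continuous g} := derivable1_continuous (dg t).
have contg' t : {for t, continuous (derive1 g)}.
  exact/derivable1_continuous/(sg 1 t).
pose k t := F (g t) (derive1 g t).
have ck t : a <= t <= b -> {for t, continuous k}.
  by move=> tab; apply: continuous_along => //; exact: Og.
have Fk t : a < t < b -> F (c t) (derive1 c t) = k t.
  move=> /andP[at_ tb]; rewrite /k -cg ?ltW//; congr (F _ _).
  rewrite !derive1E; apply: near_eq_derive.
  near=> u; apply: cg; apply/andP; split; apply/ltW.
    by near: u; exact: lt_nbhsr.
  by near: u; exact: lt_nbhsl.
have [ci ->] := eq_integral_itv_oo Fk (continuous_itv_integrable ck).
split=> //; rewrite !cg ?lexx ?ab//.
apply: (@growth_le_integral _ (rho \o g)) => //.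
  apply: continuous_in_subspaceT => t /set_mem /=; rewrite in_itv /= => tab.
  by apply: continuous_comp => //; apply: crho; exact: Og.
move=> t e /andP[at_ tb] e0 /=.
have tab : a <= t <= b by rewrite !ltW.
pose w s := s^-1 *: (g (t + s) - g t).
have cw : w s @[s --> (0:R)^'+] --> derive1 g t.
  have /is_derive_epsP dgt : is_derive t 1 g (derive1 g t).
    by apply: DeriveDef; [exact: dg | rewrite derive1E].
  apply/cvgrPdist_le => r r0; have /near_at_right dgr := dgt r r0.
  near=> s; have s0 : 0 < s by [].
  have -> : derive1 g t - w s = - (s^-1 *: (g (t + s *: 1) - g t - s *: derive1 g t)).
    by rewrite scalerBr scalerK ?gt_eqF// opprB /w [s *: 1]mulr1.
  rewrite normrN normrZ normfV gtr0_norm// ler_pdivrMl// -[X in _ <= X * _](gtr0_norm s0) mulrC.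
  by near: s.
have [[P Q] /= [P0 Qy] PQ] := growth (derive1 g t) (Og t tab) e0.
near=> s.
have s0 : 0 < s by [].
have -> : g (t + s) = g t + s *: w s by rewrite /w scalerKV ?gt_eqF// subrKC.
apply: (PQ (s, w s)); split => /=; first by near: s.
by near: s; exact: cw.
Unshelve. all: by end_near. Qed.

(** The left end is an arbitrary [a] so that the induction on break points can drop the first
    piece. *)
Lemma partition_growth (c : R -> V) a (s : seq R) : path <%R a s ->
  (forall i, (i < size s)%N ->
     exists2 g : R -> V, smooth_curve g &
       forall t, nth 1 (a :: s) i <= t <= nth 1 (a :: s) i.+1 -> c t = g t) ->
  (forall t, a <= t <= last a s -> Omega (c t)) ->
  mu.-integrable `[a, last a s] (EFin \o (fun t => F (c t) (derive1 c t))) /\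
  rho (c (last a s)) - rho (c a)
    <= \int[mu]_(t in `[a, last a s]) F (c t) (derive1 c t).
Proof.
elim: s a => [|b s IHs] a /=.
  move=> _ _ _; rewrite set_itv1 Rintegral_set1 subrr; split=> //.
  rewrite -(set_itv1 a); apply: integrable_itv_oo_cc.
  rewrite set_itv_ge ?bnd_simp ?ltxx//; exact: integrable_set0.
move=> /andP[ab bs] cs Oc.
have bl : b <= last b s.
  by have := @itv_partition_le _ _ b (last b s) s; apply; split.
have [g sg cg] := cs 0%N isT.
have [||abi abg] := @smooth_piece_growth c g a b (ltW ab) sg.
- exact: cg.
- by move=> t /andP[at_ tb]; apply: Oc; rewrite at_ (le_trans tb).
have [|||bli blg] := IHs b.
- exact: bs.
- by move=> i si; exact: (cs i.+1).
- by move=> t /andP[bt tl]; apply: Oc; rewrite tl (le_trans (ltW ab)).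
have [ali ->] := integral_itv_cat (ltW ab) bl abi bli.
split=> //.
have -> : rho (c (last b s)) - rho (c a) =
  (rho (c b) - rho (c a)) + (rho (c (last b s)) - rho (c b)) by ring.
exact: lerD.
Qed.

Lemma admissible_growth x1 x2 c : admissible_curve Omega x1 x2 c ->
  rho x2 - rho x1 <= \int[mu]_(t in `[0, 1]) F (c t) (derive1 c t).
Proof.
move=> [[s [ps /eqP ls] sc] Oc <- <-].
have Ol t : 0 <= t <= last 0 s -> Omega (c t) by rewrite ls; exact: Oc.
by have [_] := partition_growth ps sc Ol; rewrite ls.
Qed.

End CurveIntegral.

(** * Segments, and additivity of a projectively flat metric *)

Section Segments.
Context {R : realType} {n : nat}.
Local Notation V := 'rV[R]_n.
Local Notation mu := (@lebesgue_measure R).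
Implicit Types (Omega : set V) (d F : V -> V -> R).

Lemma convex_segment Omega x1 x2 t : convex_domain Omega ->
  Omega x1 -> Omega x2 -> 0 <= t <= 1 -> Omega (segment x1 x2 t).
Proof.
move=> [_ _ cO] O1 O2 /andP[t0 t1].
have := cO x2 x1 (Itv01 t0 t1); rewrite !inE => /(_ O2 O1).
suff -> : segment x1 x2 t = t *: x2 + (1 - t) *: x1 by [].
by rewrite /segment scalerBr scalerBl scale1r addrCA.
Qed.

Lemma segment0 (x1 x2 : V) : segment x1 x2 0 = x1.
Proof. by rewrite /segment scale0r addr0. Qed.

Lemma segment1 (x1 x2 : V) : segment x1 x2 1 = x2.
Proof. by rewrite /segment scale1r subrKC. Qed.

Lemma is_derive_segment (x1 x2 : V) (t : R) : is_derive t 1 (segment x1 x2) (x2 - x1).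
Proof.
apply/is_derive_epsP => e e0; near=> h.
rewrite /segment [h *: 1]mulr1 scalerDl addrA [X in X - _]addrC addKr subrr normr0.
by rewrite mulr_ge0 ?normr_ge0// ltW.
Unshelve. all: by end_near. Qed.

Lemma derive1_segment (x1 x2 : V) : derive1 (segment x1 x2) = cst (x2 - x1).
Proof. by apply/funext => t; rewrite derive1E; have [_ ->] := is_derive_segment x1 x2 t. Qed.

Lemma smooth_segment (x1 x2 : V) : smooth_curve (segment x1 x2).
Proof.
have d0 m : derive1n m (cst 0 : R -> V) = cst 0.
  elim: m => // m IHm; rewrite derive1Sn -[RHS]IHm; congr derive1n.
  by apply/funext => t; rewrite derive1_cst.
move=> [|[|k]] t; first by have [] := is_derive_segment x1 x2 t.
  by rewrite derive1n1 derive1_segment; exact: derivable_cst.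
rewrite !derive1Sn derive1_segment.
have -> : derive1 (cst (x2 - x1) : R -> V) = cst 0.
  by apply/funext => u; rewrite derive1_cst.
rewrite d0; exact: derivable_cst.
Qed.

Lemma admissible_segment Omega x1 x2 : convex_domain Omega ->
  Omega x1 -> Omega x2 -> admissible_curve Omega x1 x2 (segment x1 x2).
Proof.
move=> cO O1 O2; split; rewrite ?segment0 ?segment1//.
  exists [:: 1]; first exact: itv_partition1.
  move=> i _; exists (segment x1 x2) => //; exact: smooth_segment.
by move=> t; exact: convex_segment.
Qed.

(** One inequality is the triangle inequality. For the other, [[:: t; 1]] is one of the partitions
    in the supremum equal to [d x1 x2]; partitions being strictly increasing, t = 0 and t = 1 are
    treated apart. *)
Lemma projectively_flat_split Omega d x1 x2 t :
  convex_domain Omega -> asymmetric_metric Omega d -> projectively_flat Omega d ->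
  Omega x1 -> Omega x2 -> 0 <= t <= 1 ->
  d x1 x2 = d x1 (segment x1 x2 t) + d (segment x1 x2 t) x2.
Proof.
move=> cO md fd O1 O2 t01.
have Ot : Omega (segment x1 x2 t) by exact: convex_segment.
have d0 x : Omega x -> d x x = 0 by move=> Ox; apply/(am_eq0 md).
have /andP[+ +] := t01.
rewrite le_eqVlt => /predU1P[<- _|t0]; first by rewrite segment0 d0// add0r.
rewrite le_eqVlt => /predU1P[->|t1]; first by rewrite segment1 d0// addr0.
apply/eqP; rewrite eq_le (am_triangle md)//=.
rewrite -lee_fin (fd _ _ O1 O2); apply: ereal_sup_ubound.
exists [:: t; 1]; first by split; rewrite /= ?t0 ?t1.
by rewrite /= !big_ord_recr big_ord0 /= add0r segment0 segment1.
Qed.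

Lemma projectively_flat_add Omega d x v s t :
  convex_domain Omega -> asymmetric_metric Omega d -> projectively_flat Omega d ->
  Omega x -> Omega (x + (s + t) *: v) -> 0 <= s -> 0 <= t ->
  d x (x + (s + t) *: v) =
    d x (x + s *: v) + d (x + s *: v) (x + (s + t) *: v).
Proof.
move=> cO md fd Ox Oxv s0 t0.
have [st0|st0] := eqVneq (s + t) 0.
  have [-> ->] : s = 0 /\ t = 0 by split; lra.
  rewrite addr0 scale0r addr0; have -> : d x x = 0 by apply/(am_eq0 md).
  by rewrite addr0.
have st : 0 < s + t by rewrite lt_neqAle eq_sym st0 addr_ge0.
have -> : x + s *: v = segment x (x + (s + t) *: v) (s / (s + t)).
  by rewrite /segment [x + _ - x]addrC addKr scalerA divfK.
apply: (projectively_flat_split cO md fd) => //.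
by rewrite divr_ge0 ?addr_ge0//= ler_pdivrMr// mul1r lerDl.
Qed.

Lemma within_open_continuous (T U : topologicalType) (A : set T) (f : T -> U) x :
  open A -> {within A, continuous f} -> A x -> {for x, continuous f}.
Proof.
by move=> oA; rewrite continuous_open_subspace// => cf Ax; apply: cf; exact/mem_set.
Qed.

Lemma open_setX (T U : topologicalType) (A : set T) (B : set U) :
  open A -> open B -> open (A `*` B).
Proof.
rewrite !openE => oA oB [x y] [/= /oA Ax /oB By].
by exists (A, B).
Qed.

Lemma asymmetric_metric_continuous Omega d x1 x2 : open Omega ->
  asymmetric_metric Omega d -> Omega x1 -> Omega x2 ->
  {for (x1, x2), continuous (fun p : V * V => d p.1 p.2)}.
Proof.
move=> oO [cd _ _ _] O1 O2.
by apply: within_open_continuous cd _ => //; exact: open_setX.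
Qed.

Lemma pseudo_norm_function_continuous Omega F x y : open Omega ->
  pseudo_norm_function Omega F -> Omega x ->
  {for (x, y), continuous (fun p : V * V => F p.1 p.2)}.
Proof.
move=> oO [cF _] Ox.
by apply: within_open_continuous cF _ => //; apply: open_setX => //; exact: openT.
Qed.

End Segments.

(** * A right derivative of the metric on the diagonal induces it *)

Section Tangent.
Context {R : realType} {n : nat}.
Local Notation V := 'rV[R]_n.
Local Notation mu := (@lebesgue_measure R).

(** The right derivative at 0 of s |-> d(x, x + s v). Only s > 0 makes sense, since F x is merely
    positively homogeneous. *)
Definition tangent_function (Omega : set V) (d F : V -> V -> R) :=
  forall x v e, Omega x -> 0 < e ->
    \forall s \near 0^'+, `|d x (x + s *: v) - s * F x v| <= e * s.

Definition locally_bounded_by_norm (Omega : set V) (d : V -> V -> R) :=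
  forall x, Omega x -> exists2 C, 0 < C &
    \forall z1 \near x & z2 \near x, d z1 z2 <= C * `|z2 - z1|.

Variables (Omega : set V) (d F : V -> V -> R).
Hypotheses (cO : convex_domain Omega) (md : asymmetric_metric Omega d)
  (fd : projectively_flat Omega d) (pF : pseudo_norm_function Omega F)
  (tF : tangent_function Omega d F) (bd : locally_bounded_by_norm Omega d).

Let oO : open Omega. Proof. by case: cO. Qed.

Lemma metric_continuousr x1 x : Omega x1 -> Omega x -> {for x, continuous (d x1)}.
Proof.
move=> O1 Ox; have cd := asymmetric_metric_continuous oO md O1 Ox.
apply: (@continuous2_cvg _ _ _ _ (nbhs x) _ (cst x1) id d x1 x).
- exact: cd.
- exact: cvg_cst.
- exact: cvg_id.
Qed.

(** Triangle inequality through x + s y: [tF] controls the fixed direction y, and [bd] charges at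
    most C s |w - y| for passing from y to a nearby w. *)
Lemma metric_growth x1 x y e : Omega x1 -> Omega x -> 0 < e ->
  \forall s \near 0^'+ & w \near y,
    d x1 (x + s *: w) - d x1 x <= s * (F x y + e).
Proof.
move=> O1 Ox e0; have [C C0 bC] := bd Ox.
have e2 : 0 < e / 2 by rewrite divr_gt0.
have e2C : 0 < e / 2 / C by rewrite divr_gt0.
have := tF y Ox e2 => ty.
case: bC => -[P Q] [/= Px Qx] PQ.
have : \forall z \near x, [/\ P z, Q z & Omega z].
  have Ox' : nbhs x Omega by exact: open_nbhs_nbhs.
  by near=> z; split; near: z.
move=> /nbhs_ballP[r /= r0 rx].
have y1 : 0 < `|y| + 1 by rewrite ltr_wpDl.
have ballx s w : 0 < s -> s * (`|y| + 1) < r -> `|w - y| <= 1 ->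
    ball x r (x + s *: w).
  move=> s0 sr wy; rewrite -ball_normE /ball_ /= opprD addrA subrr add0r normrN.
  rewrite normrZ gtr0_norm//; apply: le_lt_trans sr; rewrite ler_pM2l//.
  by rewrite -[w](subrK y) addrC (le_trans (ler_normD _ _))// lerD2l.
near=> s w => /=.
have s0 : 0 < s by near: s; exact: nbhs_right_gt.
have sr : s * (`|y| + 1) < r.
  by rewrite -ltr_pdivlMr//; near: s; apply: nbhs_right_lt; rewrite divr_gt0.
have wy1 : `|w - y| <= 1.
  by rewrite distrC; near: w; apply: cvgr_dist_le.
have d1 : `|d x (x + s *: y) - s * F x y| <= e / 2 * s by near: s.
have [] := rx _ (ballx s y s0 sr _); first by rewrite subrr normr0.
move=> Psy _ Osy; have [_ Qsw Osw] := rx _ (ballx s w s0 sr wy1).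
have d2 : d (x + s *: y) (x + s *: w) <= C * `|(x + s *: w) - (x + s *: y)|.
  by apply: (PQ (_, _)).
have wy : `|w - y| <= e / 2 / C.
  by rewrite distrC; near: w; apply: cvgr_dist_le.
have d3 : d (x + s *: y) (x + s *: w) <= s * (e / 2).
  apply: le_trans d2 _; rewrite opprD addrACA subrr add0r -scalerBr normrZ gtr0_norm//.
  by rewrite mulrCA ler_pM2l// mulrC -ler_pdivlMr.
have t1 := am_triangle md O1 Ox Osw.
have t2 := am_triangle md Ox Osy Osw.
have {}d1 : d x (x + s *: y) <= s * F x y + e / 2 * s.
  by rewrite -lerBlDl; exact: le_trans (ler_norm _) d1.
have -> : s * (F x y + e) = (s * F x y + e / 2 * s) + s * (e / 2) by field.
lra.
Unshelve. all: by end_near. Qed.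

Lemma metric_le_length x1 x2 c : admissible_curve Omega x1 x2 c ->
  d x1 x2 <= \int[mu]_(t in `[0, 1]) F (c t) (derive1 c t).
Proof.
move=> ac; have O1 : Omega x1 by rewrite -(ac_start ac); apply: (ac_sub ac); rewrite lexx ler01.
have cF x y : Omega x -> {for (x, y), continuous (fun p : V * V => F p.1 p.2)}.
  exact: pseudo_norm_function_continuous.
have cd x : Omega x -> {for x, continuous (d x1)} by exact: metric_continuousr.
have := admissible_growth cF cd (fun x y e Ox => @metric_growth x1 x y e O1 Ox) ac.
by have -> : d x1 x1 = 0 by [apply/(am_eq0 md)]; rewrite subr0.
Qed.

(** The segment is an admissible curve, which gives one inequality. For the other, additivity turns
    the increment of [d x1] along the segment into [d] between two consecutive points, so that [tF]
    bounds its growth from below as well; the comparison is then applied to - d x1. *)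
Lemma metric_segment_integral x1 x2 : Omega x1 -> Omega x2 ->
  d x1 x2 = \int[mu]_(t in `[0, 1]) F (segment x1 x2 t) (x2 - x1).
Proof.
move=> O1 O2; have d0 : d x1 x1 = 0 by apply/(am_eq0 md).
have Os t : 0 <= t <= 1 -> Omega (segment x1 x2 t) by exact: convex_segment.
apply/eqP; rewrite eq_le; apply/andP; split.
  have := metric_le_length (admissible_segment cO O1 O2).
  by under eq_Rintegral do rewrite derive1_segment.
have cs (t : R) : {for t, continuous (segment x1 x2)}.
  by apply: derivable1_continuous; case: (is_derive_segment x1 x2 t).
have ck t : 0 <= t <= 1 ->
    {for t, continuous (fun t => F (segment x1 x2 t) (x2 - x1))}.
  move=> t01; apply: (@continuous_along _ _ Omega F _ (segment x1 x2) (cst (x2 - x1))).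
  - by move=> x y; exact: pseudo_norm_function_continuous.
  - exact: Os.
  - exact: cs.
  - exact: cvg_cst.
rewrite -lerN2 -[leRHS]mulN1r -RintegralZl//; last exact: continuous_itv_integrable.
under eq_Rintegral do rewrite mulN1r.
have -> : - d x1 x2 = - d x1 (segment x1 x2 1) - - d x1 (segment x1 x2 0).
  by rewrite segment1 segment0 d0 oppr0 subr0.
apply: (@growth_le_integral _ (fun t => - d x1 (segment x1 x2 t))) => //.
- apply: continuous_in_subspaceT => t /set_mem /=; rewrite in_itv /= => t01.
  apply: cvgN; apply: (@continuous_comp _ _ _ (segment x1 x2) (d x1)); first exact: cs.
  by apply: metric_continuousr => //; exact: Os.
- by move=> t t01; apply: cvgN; exact: ck.
move=> t e /andP[t0 t1] e0.
have Ot : Omega (segment x1 x2 t) by apply: Os; rewrite !ltW.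
have := tF (x2 - x1) Ot e0 => tFt.
near=> s.
have s0 : 0 < s by near: s; exact: nbhs_right_gt.
have st1 : t + s <= 1.
  by rewrite -lerBrDl; near: s; apply: nbhs_right_le; rewrite subr_gt0.
have segD : segment x1 x2 (t + s) = segment x1 x2 t + s *: (x2 - x1).
  by rewrite /segment scalerDl addrA.
have : `|d (segment x1 x2 t) (segment x1 x2 t + s *: (x2 - x1))
         - s * F (segment x1 x2 t) (x2 - x1)| <= e * s by near: s.
rewrite ler_norml -segD => /andP[+ _].
have := projectively_flat_add (v := x2 - x1) cO md fd O1 _ (ltW t0) (ltW s0).
move=> /(_ (Os _ _)) ->; last by rewrite st1 addr_ge0// ltW.
rewrite -/(segment x1 x2 t) -/(segment x1 x2 (t + s)); lra.
Unshelve. all: by end_near. Qed.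

(** The infimum is a minimum, attained by the segment. *)
Lemma tangent_function_induced : induced_by Omega d F.
Proof.
move=> x1 x2 O1 O2.
pose L := [set (\int[mu]_(t in `[0, 1]) F (c t) (derive1 c t))%R
      | c in admissible_curve Omega x1 x2].
have Ld : L (d x1 x2).
  exists (segment x1 x2); first exact: admissible_segment.
  rewrite metric_segment_integral//.
  by under eq_Rintegral do rewrite derive1_segment.
have lbL : lbound L (d x1 x2) by move=> _ [c ac <-]; exact: metric_le_length.
apply/eqP; rewrite eq_le; apply/andP; split.
  by apply: lb_le_inf => //; exists (d x1 x2).
by apply: ge_inf => //; exists (d x1 x2).
Qed.

End Tangent.

(** * From local Euclidean bounds to a pseudo-norm function *)

Section EuclideanNorm.
Context {R : realType} {n : nat}.
Local Notation V := 'rV[R]_n.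
Implicit Types (x y : V).

Lemma norm_coord_le x i : `|x 0 i| <= `|x|.
Proof. by rewrite [leRHS]mx_normrE; exact: (le_bigmax _ (fun j => `|x j.1 j.2|) (0, i)). Qed.

Lemma norm_le_enorm x : `|x| <= enorm x.
Proof.
rewrite [leLHS]mx_normrE; apply: bigmax_le => [|[j i] _]; first exact: sqrtr_ge0.
rewrite /= ord1 -sqrtr_sqr /enorm ler_wsqrtr// (bigD1 i)//= lerDl.
by apply: sumr_ge0 => k _; exact: sqr_ge0.
Qed.

(** The constant [n.+1] is crude, but it stays positive in dimension 0 and can be divided by. *)
Lemma enorm_le_norm x : enorm x <= n.+1%:R * `|x|.
Proof.
have nx : 0 <= n.+1%:R * `|x| by rewrite mulr_ge0.
rewrite /enorm -(ger0_norm nx) -sqrtr_sqr ler_wsqrtr//.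
apply: (@le_trans _ _ (\sum_(i < n) `|x| ^+ 2)).
  apply: ler_sum => i _; rewrite -real_normK ?num_real//.
  by rewrite lerXn2r ?nnegrE// norm_coord_le.
rewrite sumr_const card_ord exprMn -[_ *+ n]mulr_natl ler_wpM2r ?sqr_ge0//.
rewrite -natrX ler_nat; apply: (@leq_trans n.+1) => //.
by rewrite leq_pmulr.
Qed.

Lemma enorm_ge0 x : 0 <= enorm x. Proof. exact: sqrtr_ge0. Qed.

Lemma ball_sub_eball x r : ball x (r / n.+1%:R) `<=` eball x r.
Proof.
move=> z; rewrite -ball_normE /ball_ /= -normrN opprB => zx.
apply: le_lt_trans (enorm_le_norm _) _.
by rewrite mulrC -ltr_pdivlMr.
Qed.

Lemma eball_sub_ball x r : eball x r `<=` ball x r.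
Proof.
move=> z zx; rewrite -ball_normE /ball_ /= -normrN opprB.
exact: le_lt_trans (norm_le_enorm _) zx.
Qed.

(** The local bounds in the sup norm, with the constants as parameters so that several estimates can
    share them. *)
Definition local_norm_bounds (Omega : set V) (d : V -> V -> R) x (r c C : R) :=
  [/\ 0 < r, 0 < c, 0 < C, ball x r `<=` Omega
    & forall x1 x2 y, ball x r x1 -> ball x r x2 ->
        ball x r (x1 + y) -> ball x r (x2 + y) ->
        (c * `|x2 - x1| <= d x1 x2 <= C * `|x2 - x1|) /\
        `|d x1 (x1 + y) - d x2 (x2 + y)| <= C * `|y| * `|x2 - x1|].

Lemma locally_euclidean_boundsP (Omega : set V) (d : V -> V -> R) :
  locally_euclidean_bounds Omega d <->
  forall x, Omega x -> exists r c C, local_norm_bounds Omega d x r c C.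
Proof.
set N : R := n.+1%:R; have N0 : 0 < N by [].
split=> [H x Ox|H x Ox]; have [r [c [C [r0 c0 C0 sub Hb]]]] := H x Ox.
  have sb := @ball_sub_eball x r.
  (* The radius shrinks so that the sup ball fits in the Euclidean one; the product |y| |x2 - x1|
     costs the factor N twice. *)
  exists (r / N), c, (C * N ^+ 2); split=> //.
  - exact: divr_gt0.
  - by rewrite mulr_gt0// exprn_gt0.
  - exact: subset_trans sb sub.
  move=> x1 x2 y /sb b1 /sb b2 /sb b3 /sb b4.
  have [/andP[H1 H2] H3] := Hb _ _ _ b1 b2 b3 b4.
  have CN (u : V) : C * enorm u <= C * N ^+ 2 * `|u|.
    rewrite -mulrA ler_pM2l//; apply: le_trans (enorm_le_norm _) _.
    rewrite -/N ler_wpM2r// expr2 ler_peMr ?(ltW N0)// /N ler1n//.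
  split; first (apply/andP; split).
  - by apply: le_trans H1; rewrite ler_pM2l// norm_le_enorm.
  - exact: le_trans H2 (CN _).
  - apply: le_trans H3 _.
    have -> : C * N ^+ 2 * `|y| * `|x2 - x1| = (C * (N * `|y|)) * (N * `|x2 - x1|) by ring.
    apply: ler_pM; rewrite ?enorm_ge0 ?mulr_ge0 ?enorm_ge0 ?(ltW C0)//.
      by rewrite ler_pM2l// enorm_le_norm.
    exact: enorm_le_norm.
exists r, (c / N), C; split=> //.
- exact: divr_gt0.
- by apply: subset_trans sub; exact: eball_sub_ball.
move=> x1 x2 y /eball_sub_ball b1 /eball_sub_ball b2.
move=> /eball_sub_ball b3 /eball_sub_ball b4.
have [/andP[H1 H2] H3] := Hb _ _ _ b1 b2 b3 b4.
split; first (apply/andP; split).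
- apply: le_trans H1; rewrite mulrAC ler_pdivrMr// -mulrA ler_pM2l// mulrC.
  exact: enorm_le_norm.
- by apply: le_trans H2 _; rewrite ler_pM2l// norm_le_enorm.
- apply: le_trans H3 _; apply: ler_pM; rewrite ?norm_le_enorm ?mulr_ge0 ?(ltW C0)//.
  by rewrite ler_pM2l// norm_le_enorm.
Qed.

End EuclideanNorm.

(** Nonnegativity and additivity give monotonicity. Enclosing k a between consecutive integers then
    shows that k times the defect |f a - a f 1| is at most f 1, for every k. *)
Lemma nonneg_additive_linear {R : realType} (f : R -> R) :
  (forall a, 0 <= a -> 0 <= f a) ->
  (forall a b, 0 <= a -> 0 <= b -> f (a + b) = f a + f b) ->
  forall a, 0 <= a -> f a = a * f 1.
Proof.
move=> f0 fD.
have f00 : f 0 = 0.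
  by have := fD 0 0 (lexx _) (lexx _); rewrite addr0 => /eqP; rewrite -subr_eq subrr eq_sym => /eqP.
have fn (k : nat) a : 0 <= a -> f (k%:R * a) = k%:R * f a.
  move=> a0; elim: k => [|k IHk]; first by rewrite !mul0r f00.
  by rewrite -natr1 !mulrDl !mul1r fD ?IHk// mulr_ge0.
have fle a b : 0 <= a -> a <= b -> f a <= f b.
  move=> a0 ab; rewrite -(subrK a b) fD ?subr_ge0// lerDr.
  by apply: f0; rewrite subr_ge0.
have f1 : 0 <= f 1 by exact: f0.
move=> a a0; apply/eqP; rewrite -subr_eq0 -normr_eq0; apply/negPn/negP => nz.
have {nz} : 0 < `|f a - a * f 1| by rewrite lt_neqAle eq_sym nz normr_ge0.
set D := `|_| => D0.
(* Chosen so that k D exceeds f 1. *)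
pose k := (Num.truncn (f 1 / D)).+1.
have kD : f 1 < k%:R * D.
  by rewrite -ltr_pdivrMr//; exact: truncnS_gt.
have k0 : (0 : R) < k%:R by [].
pose m := Num.truncn (k%:R * a).
have ka0 : 0 <= k%:R * a by rewrite mulr_ge0.
have mk : m%:R <= k%:R * a by rewrite /m truncn_le.
have km : k%:R * a <= m.+1%:R by rewrite ltW// truncnS_gt.
have : k%:R * D <= f 1.
  rewrite -[k%:R]ger0_norm// -normrM mulrBr -(fn k a a0) ler_norml.
  have := fle _ _ (ler0n _ m) mk; have := fle _ _ ka0 km.
  rewrite -[m%:R]mulr1 -[m.+1%:R]mulr1 !(fn _ 1)// -natr1 => h1 h2.
  have h3 : m%:R * f 1 <= k%:R * a * f 1 by rewrite ler_wpM2r.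
  have h4 : k%:R * a * f 1 <= (m%:R + 1) * f 1 by rewrite ler_wpM2r// natr1.
  apply/andP; split; lra.
by rewrite leNgt kD.
Qed.

(** * The dyadic directional derivative near a point *)

Section DyadicLimit.
Context {R : realType} {n : nat}.
Local Notation V := 'rV[R]_n.
Local Notation eps k := ((2 : R)^-1 ^+ k).

(** Difference quotients at t = 2^-k only: consecutive ones compare a segment with its first
    half. *)
Definition dyadic_quotient (d : V -> V -> R) (x y : V) : R^nat :=
  fun k => (eps k)^-1 * d x (x + eps k *: y).

Definition dyadic_derivative (d : V -> V -> R) (x y : V) : R :=
  limn (dyadic_quotient d x y).

Let eps_gt0 k : 0 < eps k. Proof. by rewrite exprn_gt0// invr_gt0. Qed.

Let cvg_eps : eps k @[k --> \oo] --> (0 : R).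
Proof. by apply: cvg_expr; rewrite ger0_norm ?invr_ge0// invf_lt1// ltr1n. Qed.

Let near_eps (M e : R) : 0 < e -> \forall k \near \oo, eps k * M < e.
Proof.
move=> e0; have : eps k * M @[k --> \oo] --> 0 * M by apply: cvgM => //; exact: cvg_cst.
by rewrite mul0r => /cvgr_lt; apply.
Qed.

Variables (Omega : set V) (d : V -> V -> R) (x0 : V) (r c C : R).
Hypotheses (cO : convex_domain Omega) (md : asymmetric_metric Omega d)
  (fd : projectively_flat Omega d) (hb : local_norm_bounds Omega d x0 r c C).

Let r0 : 0 < r. Proof. by case: hb. Qed.
Let C0 : 0 < C. Proof. by case: hb. Qed.
Let c0 : 0 < c. Proof. by case: hb. Qed.
Let rO : ball x0 r `<=` Omega. Proof. by case: hb. Qed.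

Let near_ball x y : ball x0 r x ->
  \forall k \near \oo, ball x0 r (x + eps k *: y).
Proof.
rewrite -ball_normE /ball_ /= => xr.
have e0 : 0 < r - `|x0 - x| by rewrite subr_gt0.
near=> k.
rewrite opprD addrA (le_lt_trans (ler_normB _ _))// normrZ gtr0_norm//.
by rewrite -ltrBrDl; near: k; exact: near_eps.
Unshelve. all: by end_near. Qed.

(** By additivity the defect is the difference of [d] on the two halves of the segment, which are
    translates of each other by y / 2. The Lipschitz bound applies with both norms equal to |y| /
    2. *)
Let midpoint_defect x y : ball x0 r x -> ball x0 r (x + y) -> 
  `|2 * d x (x + 2^-1 *: y) - d x (x + y)| <= C * `|y| ^+ 2 / 4.
Proof.
move=> bx bxy.
have bm : ball x0 r (x + 2^-1 *: y).
  move: bx bxy; rewrite -ball_normE /ball_ /= => bx bxy.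
  have -> : x0 - (x + 2^-1 *: y) = 2^-1 *: ((x0 - x) + (x0 - (x + y))).
    by apply/matrixP => i j; rewrite !mxE; field.
  rewrite normrZ ger0_norm// mulrC ltr_pdivrMr//.
  apply: le_lt_trans (ler_normD _ _) _; lra.
have E : y = (2^-1 + 2^-1) *: y by rewrite (_ : 2^-1 + 2^-1 = 1) ?scale1r//; field.
have := projectively_flat_add (x := x) (v := y) (s := 2^-1) (t := 2^-1) cO md fd.
rewrite -E => -> //; rewrite ?invr_ge0//; [|exact: rO..].
have [_ _ _ _ Hb] := hb.
have [|_] := Hb x (x + 2^-1 *: y) (2^-1 *: y) bx bm bm.
  by rewrite -addrA -scalerDl -E.
rewrite -addrA -scalerDl -E [X in _ <= _ * _ * X](_ : _ = `|2^-1 *: y|); last first.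
  by rewrite addrC addKr.
rewrite !normrZ ger0_norm ?invr_ge0// => H.
have -> : C * `|y| ^+ 2 / 4 = C * (2^-1 * `|y|) * (2^-1 * `|y|) by field.
apply: le_trans H; rewrite le_eqVlt; apply/orP; left; apply/eqP; congr `|_|; ring.
Qed.

(** The midpoint defect at scale 2^-k, written as a multiple of a difference so that sums over k
    telescope. *)
Let quotient_defect x y k : ball x0 r x -> ball x0 r (x + eps k *: y) ->
  `|dyadic_quotient d x y k.+1 - dyadic_quotient d x y k| <=
    C * `|y| ^+ 2 / 2 * (eps k - eps k.+1).
Proof.
move=> bx bk; have := midpoint_defect bx bk.
have e0 := eps_gt0 k.
rewrite scalerA -exprS normrZ (gtr0_norm e0) => H.
rewrite /dyadic_quotient.
have -> : (eps k.+1)^-1 * d x (x + eps k.+1 *: y) - (eps k)^-1 * d x (x + eps k *: y)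
  = (eps k)^-1 * (2 * d x (x + eps k.+1 *: y) - d x (x + eps k *: y)).
  by rewrite exprS invfM invrK; ring.
rewrite normrM normfV (gtr0_norm e0) ler_pdivrMl//; apply: le_trans H _.
rewrite (exprS _ k) le_eqVlt.
by apply/orP; left; apply/eqP; field.
Qed.

Let small_quotient x y : ball x0 r x ->
  (forall k, ball x0 r (x + eps k *: y)) ->
  cvgn (dyadic_quotient d x y) /\
  `|d x (x + y) - dyadic_derivative d x y| <= C * `|y| ^+ 2 / 2.
Proof.
move=> bx bk; set a := dyadic_quotient d x y; set M := C * `|y| ^+ 2 / 2.
have M0 : 0 <= M by rewrite /M divr_ge0// mulr_ge0 ?exprn_ge0// ltW.
have aq k : `|a k.+1 - a k| <= M * (eps k - eps k.+1) by exact: quotient_defect.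
have a0 k : 0 <= a k.
  rewrite /a /dyadic_quotient; apply: mulr_ge0; first by rewrite invr_ge0 ltW.
  by apply: (am_ge0 md); apply: rO.
have E0 : eps 0 = 1 by rewrite expr0.
(* The added term absorbs the possible increase of [a], so [b] is nonincreasing and nonnegative,
   hence convergent. *)
pose b k := a k + M * eps k.
have cb : cvgn b.
  apply: nonincreasing_is_cvgn.
    apply/nonincreasing_seqP => k; rewrite /b.
    have := aq k; rewrite ler_norml => /andP[_]; rewrite mulrBr; lra.
  by exists 0 => _ [k _ <-]; rewrite /b addr_ge0// mulr_ge0// ltW.
have cM : M * eps k @[k --> \oo] --> M * 0 by apply: cvgM => //; exact: cvg_cst.
have ca : cvgn a.
  have -> : a = b - (fun k => M * eps k) by apply/funext => k; rewrite fctE /b addrK.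
  by apply: is_cvgB => //; exact: cvgP cM.
split=> //; rewrite /dyadic_derivative -/a.
have a00 : a 0%N = d x (x + y) by rewrite /a /dyadic_quotient E0 invr1 mul1r scale1r.
rewrite -a00.
suff near0 k : `|a k - a 0%N| <= M * (1 - eps k).
  have ca0 : `|a k - a 0%N| @[k --> \oo] --> `|limn a - a 0%N|.
    by apply: cvg_norm; apply: cvgB => //; exact: cvg_cst.
  rewrite distrC; apply: (cvgr_to_le ca0); near=> k.
  apply: le_trans (near0 k) _.
  by rewrite -[leRHS]mulr1 ler_wpM2l// gerBl ltW.
elim: k => [|k IHk]; first by rewrite subrr normr0 E0 subrr mulr0.
have -> : a k.+1 - a 0%N = (a k.+1 - a k) + (a k - a 0%N) by ring.
apply: le_trans (ler_normD _ _) _.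
have -> : M * (1 - eps k.+1) = M * (eps k - eps k.+1) + M * (1 - eps k) by ring.
exact: lerD.
Unshelve. all: by end_near. Qed.

Let small_ball x y : ball x0 (r / 2) x -> `|y| < r / 2 ->
  forall k, ball x0 r (x + eps k *: y).
Proof.
rewrite -!ball_normE /ball_ /= => bx yr k.
rewrite opprD addrA (le_lt_trans (ler_normB _ _))//.
have -> : r = r / 2 + r / 2 by field.
apply: ltrD => //; apply: le_lt_trans yr.
by rewrite normrZ gtr0_norm// ler_piMl// exprn_ile1// ?invr_ge0// invf_le1// ler1n.
Qed.

Let half_ball : ball x0 (r / 2) `<=` ball x0 r.
Proof. by apply: le_ball; rewrite ler_pdivrMr// ler_peMr ?ler1n// ltW. Qed.

Lemma dyadic_derivative_approx x y : ball x0 (r / 2) x -> `|y| < r / 2 ->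
  `|d x (x + y) - dyadic_derivative d x y| <= C * `|y| ^+ 2 / 2.
Proof.
move=> bx yr; have [|//] := @small_quotient x y (half_ball bx).
exact: small_ball.
Qed.

(** For a large y, halve it m times until it is small: the quotients of y from rank m on are those
    of 2^-m y, rescaled. *)
Lemma dyadic_quotient_cvg x y : ball x0 (r / 2) x ->
  dyadic_quotient d x y k @[k --> \oo] --> dyadic_derivative d x y.
Proof.
move=> bx; have rr : 0 < r / 2 by rewrite divr_gt0.
have [m _ /(_ m (leqnn _)) /= mr] := near_eps `|y| rr.
have [|+ _] := @small_quotient x (eps m *: y) (half_ball bx).
  by apply: small_ball => //; rewrite normrZ gtr0_norm.
move=> cm; suff : cvgn (dyadic_quotient d x y) by [].
apply/cvg_ex; exists ((eps m)^-1 * dyadic_derivative d x (eps m *: y)).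
rewrite -(cvg_shiftn m).
rewrite (_ : [sequence _]_k =
    fun k => (eps m)^-1 * dyadic_quotient d x (eps m *: y) k).
  by apply: cvgM => //; exact: cvg_cst.
apply/funext => k; rewrite /dyadic_quotient /= scalerA exprD invfM mulrA.
by rewrite [_^-1 * _^-1]mulrC.
Qed.

Lemma dyadic_derivative_bounds x y : ball x0 (r / 2) x ->
  c * `|y| <= dyadic_derivative d x y <= C * `|y|.
Proof.
move=> bx; have cx := @dyadic_quotient_cvg _ y bx; have bx' := half_ball bx.
have H : \forall k \near \oo,
    c * `|y| <= dyadic_quotient d x y k <= C * `|y|.
  have := @near_ball _ y bx'; apply: filterS => k bk.
  have [_ _ _ _ Hb] := hb.
  have [||+ _] := Hb x (x + eps k *: y) 0 bx' bk; rewrite ?addr0//.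
  rewrite [_ - x]addrC addKr normrZ (gtr0_norm (eps_gt0 k)) => /andP[H1 H2].
  rewrite /dyadic_quotient ler_pdivlMl// ler_pdivrMl//.
  by rewrite mulrCA H1 mulrCA H2.
by apply/andP; split; [apply: cvgr_to_ge cx _ | apply: cvgr_to_le cx _];
  apply: filterS H => k /andP[].
Qed.

Lemma dyadic_derivative_lipschitz x1 x2 y :
  ball x0 (r / 2) x1 -> ball x0 (r / 2) x2 ->
  `|dyadic_derivative d x1 y - dyadic_derivative d x2 y| <= C * `|y| * `|x2 - x1|.
Proof.
move=> bx1 bx2.
have cx : `|dyadic_quotient d x1 y k - dyadic_quotient d x2 y k| @[k --> \oo] -->
    `|dyadic_derivative d x1 y - dyadic_derivative d x2 y|.
  by apply: cvg_norm; apply: cvgB; exact: dyadic_quotient_cvg.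
apply: cvgr_to_le cx _.
have := @near_ball _ y (half_ball bx2); have := @near_ball _ y (half_ball bx1).
apply: filterS2 => k bk1 bk2.
have [_ _ _ _ Hb] := hb.
have [_] := Hb _ _ _ (half_ball bx1) (half_ball bx2) bk1 bk2.
rewrite normrZ (gtr0_norm (eps_gt0 k)) => H.
rewrite /dyadic_quotient -mulrBr normrM normfV (gtr0_norm (eps_gt0 k)) ler_pdivrMl//.
by apply: le_trans H _; rewrite mulrCA !mulrA.
Qed.

(** After the triangle inequality through x + 2^-k y1, the second leg is moved back to base point x.
    This costs C 4^-k |y1| |y2|, which vanishes even after division by 2^-k. *)
Lemma dyadic_derivative_subadd x y1 y2 : ball x0 (r / 2) x ->
  dyadic_derivative d x (y1 + y2) <=
    dyadic_derivative d x y1 + dyadic_derivative d x y2.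
Proof.
move=> bx; have bx' := half_ball bx.
have cE : eps k * (C * `|y1| * `|y2|) @[k --> \oo] --> 0 * (C * `|y1| * `|y2|).
  by apply: cvgM => //; exact: cvg_cst.
have cDE : dyadic_quotient d x y1 k + dyadic_quotient d x y2 k +
    eps k * (C * `|y1| * `|y2|) @[k --> \oo] -->
    dyadic_derivative d x y1 + dyadic_derivative d x y2.
  rewrite -[X in _ --> X]addr0 -(mul0r (C * `|y1| * `|y2|)).
  by apply: cvgD => //; apply: cvgD; exact: dyadic_quotient_cvg.
apply: ler_cvg_to (@dyadic_quotient_cvg _ (y1 + y2) bx) cDE _.
have := @near_ball _ (y1 + y2) bx'.
have := @near_ball _ y2 bx'; have := @near_ball _ y1 bx'.
apply: filterS3 => k b1 b2; rewrite scalerDr addrA => b12.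
have [_ _ _ _ Hb] := hb.
have [_] := Hb _ _ _ bx' b1 b2 b12.
have t := am_triangle md (rO bx') (rO b1) (rO b12).
rewrite [_ - x]addrC addKr !normrZ !(gtr0_norm (eps_gt0 k)) => H.
have {}H : d (x + eps k *: y1) (x + eps k *: y1 + eps k *: y2) <=
    d x (x + eps k *: y2) + C * (eps k * `|y2|) * (eps k * `|y1|).
  by move: H; rewrite ler_norml => /andP[+ _]; lra.
rewrite /= /dyadic_quotient ler_pdivrMl// [eps k *: (y1 + y2)]scalerDr [x + (_ + _)]addrA !mulrDr !mulVKf ?gt_eqF//.
apply: le_trans t _; move: H; lra.
Qed.

(** On a ray, additivity of [d] replaces the triangle inequality, so moving the second leg back to x
    gives an equality in the limit. *)
Lemma dyadic_derivative_add x y a b : ball x0 (r / 2) x -> 0 <= a -> 0 <= b ->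
  dyadic_derivative d x ((a + b) *: y) =
    dyadic_derivative d x (a *: y) + dyadic_derivative d x (b *: y).
Proof.
move=> bx a0 b0; have bx' := half_ball bx.
pose u k := `|dyadic_quotient d x ((a + b) *: y) k -
  (dyadic_quotient d x (a *: y) k + dyadic_quotient d x (b *: y) k)|.
have cu : u k @[k --> \oo] --> `|dyadic_derivative d x ((a + b) *: y) -
    (dyadic_derivative d x (a *: y) + dyadic_derivative d x (b *: y))|.
  by apply: cvg_norm; apply: cvgB; [|apply: cvgD]; exact: dyadic_quotient_cvg.
have cE : eps k * (C * `|a *: y| * `|b *: y|) @[k --> \oo] -->
    0 * (C * `|a *: y| * `|b *: y|).
  by apply: cvgM => //; exact: cvg_cst.
suff H : \forall k \near \oo, u k <= eps k * (C * `|a *: y| * `|b *: y|).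
  apply/eqP; rewrite -subr_eq0 -normr_eq0 eq_le normr_ge0 andbT.
  by rewrite -(mul0r (C * `|a *: y| * `|b *: y|)); exact: (ler_cvg_to cu cE H).
have := @near_ball _ ((a + b) *: y) bx'.
have := @near_ball _ (b *: y) bx'; have := @near_ball _ (a *: y) bx'.
apply: filterS3 => k b1 b2 b12.
have e0 := eps_gt0 k.
have ADD : d x (x + eps k *: ((a + b) *: y)) = d x (x + eps k *: (a *: y)) +
   d (x + eps k *: (a *: y)) (x + eps k *: (a *: y) + eps k *: (b *: y)).
  rewrite -addrA -scalerDr -scalerDl [eps k *: (_ *: y)]scalerA.
  rewrite mulrDr [eps k *: (a *: y)]scalerA.
  apply: (projectively_flat_add cO md fd); rewrite ?mulr_ge0 ?(ltW e0)//.
    exact: rO.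
  by apply: rO; rewrite -mulrDr -scalerA.
have [_ _ _ _ Hb] := hb.
have [|_] := Hb _ _ (eps k *: (b *: y)) bx' b1 b2.
  by rewrite -addrA -scalerDr -scalerDl.
rewrite [_ - x]addrC addKr [`|eps k *: _|]normrZ [`|eps k *: (a *: y)|]normrZ !(gtr0_norm e0) => H.
rewrite /u /dyadic_quotient ADD.
have -> (p q s : R) : (eps k)^-1 * (p + q) - ((eps k)^-1 * p + (eps k)^-1 * s) =
  - ((eps k)^-1 * (s - q)) by ring.
rewrite normrN normrM normfV (gtr0_norm e0) ler_pdivrMl//; apply: le_trans H _.
by rewrite le_eqVlt; apply/orP; left; apply/eqP; ring.
Qed.

Lemma dyadic_derivative_pseudo_norm x : ball x0 (r / 2) x ->
  pseudo_norm (dyadic_derivative d x).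
Proof.
move=> bx; have H y := @dyadic_derivative_bounds _ y bx.
have G0 y : 0 <= dyadic_derivative d x y.
  by have /andP[+ _] := H y; apply: le_trans; rewrite mulr_ge0// ltW.
split=> //.
- move=> y; split=> [y0|->].
    have /andP[+ _] := H y; rewrite y0 pmulr_rle0// normr_le0 => /eqP//.
  by apply/eqP; rewrite eq_le G0 andbT; have /andP[_] := H 0; rewrite normr0 mulr0.
- move=> a y a0.
  (* Dyadic quotients rescale only by powers of 2; homogeneity for real factors comes from
     additivity and nonnegativity along the ray. *)
  have := @nonneg_additive_linear R (fun a => dyadic_derivative d x (a *: y)).
  rewrite scale1r; apply => //; last exact: ltW.
  by move=> u v u0 v0; exact: dyadic_derivative_add.
- by move=> y1 y2; exact: dyadic_derivative_subadd.
Qed.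

End DyadicLimit.

Lemma near_fst (T U : topologicalType) (x : T) (y : U) (P : set T) :
  (\forall u \near x, P u) -> \forall p \near (x, y), P p.1.
Proof.
by move=> Px; exists (P, setT) => [|[u v] []//]; split=> //; exact: filterT.
Qed.

Lemma near_snd (T U : topologicalType) (x : T) (y : U) (P : set U) :
  (\forall v \near y, P v) -> \forall p \near (x, y), P p.2.
Proof.
by move=> Py; exists (setT, P) => [|[u v] []//]; split=> //; exact: filterT.
Qed.

(** * The dyadic derivative as a pseudo-norm function inducing the metric *)

Section BoundsToPseudoNorm.
Context {R : realType} {n : nat}.
Local Notation V := 'rV[R]_n.
Variables (Omega : set V) (d : V -> V -> R).
Hypotheses (cO : convex_domain Omega) (md : asymmetric_metric Omega d)
  (fd : projectively_flat Omega d).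
Hypothesis hb : forall x, Omega x -> exists r c C, local_norm_bounds Omega d x r c C.

Local Notation F := (dyadic_derivative d).

Let Fpn x : Omega x -> pseudo_norm (F x).
Proof.
move=> Ox; have [r [c [C h]]] := hb Ox; have [r0 _ _ _ _] := h.
by apply: (dyadic_derivative_pseudo_norm cO md fd h); apply: ballxx; rewrite divr_gt0.
Qed.

(** The Lipschitz bound handles the base point. In the vector, subadditivity and the upper bound C
    |y| give a Lipschitz constant C uniform over base points near x. *)
Lemma dyadic_derivative_continuous x y : Omega x ->
  {for (x, y), continuous (fun p : V * V => F p.1 p.2)}.
Proof.
move=> Ox; have [r [c [C h]]] := hb Ox; have [r0 c0 C0 rO _] := h.
have r2 : 0 < r / 2 by rewrite divr_gt0.
have A0 : 0 < C * `|y| + 1 by rewrite ltr_wpDl// mulr_ge0// ltW.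
apply/cvgrPdist_le => e e0.
have e2 : 0 < e / 2 by rewrite divr_gt0.
have N1 : \forall u \near x, `|x - u| <= e / 2 / (C * `|y| + 1).
  by apply: (@cvgr_dist_le _ _ _ (nbhs x) _ id x); rewrite ?divr_gt0.
have N2 : \forall u \near y, `|y - u| <= e / 2 / C.
  by apply: (@cvgr_dist_le _ _ _ (nbhs y) _ id y); rewrite ?divr_gt0.
near=> p.
have bp : ball x (r / 2) p.1.
  by near: p; apply: (@near_fst _ _ x y (ball x (r / 2))); exact: nbhsx_ballx.
have bx : ball x (r / 2) x by exact: ballxx.
have p1 : `|x - p.1| <= e / 2 / (C * `|y| + 1).
  by near: p; exact: near_fst N1.
have p2 : `|y - p.2| <= e / 2 / C by near: p; exact: near_snd N2.
have H1 := dyadic_derivative_lipschitz cO md fd h y bp bx.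
have bnd u := dyadic_derivative_bounds cO md fd h u bp.
have sub := dyadic_derivative_subadd cO md fd h.
have H2 : `|F p.1 y - F p.1 p.2| <= C * `|y - p.2|.
  have /andP[_ b1] := bnd (y - p.2); have /andP[_ b2] := bnd (p.2 - y).
  have s1 := sub _ p.2 (y - p.2) bp; have s2 := sub _ y (p.2 - y) bp.
  rewrite subrKC in s1; rewrite subrKC in s2; rewrite [`|p.2 - y|]distrC in b2.
  by rewrite ler_norml; apply/andP; split; lra.
have -> : F x y - F p.1 p.2 = (F x y - F p.1 y) + (F p.1 y - F p.1 p.2) by ring.
apply: le_trans (ler_normD _ _) _.
rewrite [X in X + _]distrC (_ : e = e / 2 + e / 2); last by field.
apply: lerD.
  apply: le_trans H1 _; rewrite ler_pdivlMr// in p1; apply: le_trans p1.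
  by rewrite mulrC ler_wpM2l// lerDl.
by apply: le_trans H2 _; rewrite mulrC -ler_pdivlMr.
Unshelve. all: by end_near. Qed.

Lemma dyadic_derivative_pseudo_norm_function : pseudo_norm_function Omega F.
Proof.
split; last exact: Fpn.
apply: continuous_in_subspaceT => -[x y] /set_mem [/= Ox _].
exact: dyadic_derivative_continuous.
Qed.

Lemma dyadic_derivative_lipschitz_function : lipschitz_pseudo_norm_function Omega F.
Proof.
move=> x Ox; have [r [c [C h]]] := hb Ox; have [r0 c0 C0 rO _] := h.
exists (ball x (r / 2)), C; split => //.
- by apply: nbhsx_ballx; rewrite divr_gt0.
- apply: subset_trans rO; apply: le_ball.
  by rewrite ler_pdivrMr// ler_peMr ?ler1n// ltW.
move=> x1 x2 y b1 b2.
apply: le_trans (dyadic_derivative_lipschitz cO md fd h y b1 b2) _.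
rewrite [`|x2 - _|]distrC; apply: ler_pM; rewrite ?norm_le_enorm ?mulr_ge0 ?(ltW C0)//.
by rewrite ler_pM2l// norm_le_enorm.
Qed.

(** The quadratic error bound holds at every small vector, dyadic or not. Applied to s v and
    combined with homogeneity, it gives an error O(s^2) for all small s > 0. *)
Lemma dyadic_derivative_tangent : tangent_function Omega d F.
Proof.
move=> x v e Ox e0; have [r [c [C h]]] := hb Ox; have [r0 c0 C0 rO _] := h.
have r2 : 0 < r / 2 by rewrite divr_gt0.
have v1 : 0 < `|v| + 1 by rewrite ltr_wpDl.
have A0 : 0 < C * `|v| ^+ 2 / 2 + 1.
  by rewrite ltr_wpDl// divr_ge0// mulr_ge0 ?exprn_ge0// ltW.
near=> s.
have s0 : 0 < s by near: s; exact: nbhs_right_gt.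
have sv : `|s *: v| < r / 2.
  rewrite normrZ gtr0_norm//; apply: (@le_lt_trans _ _ (s * (`|v| + 1))).
    by rewrite ler_pM2l// lerDl.
  by rewrite -ltr_pdivlMr//; near: s; apply: nbhs_right_lt; rewrite divr_gt0.
have se : s * (C * `|v| ^+ 2 / 2 + 1) <= e.
  by rewrite -ler_pdivlMr//; near: s; apply: nbhs_right_le; rewrite divr_gt0.
rewrite -(pn_homog (Fpn Ox))//.
have bx : ball x (r / 2) x by exact: ballxx.
apply: le_trans (dyadic_derivative_approx cO md fd h bx sv) _.
rewrite normrZ gtr0_norm//.
have -> : C * (s * `|v|) ^+ 2 / 2 = (s * (C * `|v| ^+ 2 / 2)) * s by field.
rewrite ler_pM2r//; apply: le_trans se.
by rewrite ler_pM2l// lerDl.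
Unshelve. all: by end_near. Qed.

Lemma local_norm_bounds_bounded : locally_bounded_by_norm Omega d.
Proof.
move=> x Ox; have [r [c [C h]]] := hb Ox; have [r0 c0 C0 rO Hb] := h.
exists C => //.
exists (ball x r, ball x r) => /=; first by split; exact: nbhsx_ballx.
move=> [z1 z2] /= [b1 b2].
by have [||/andP[]] := Hb z1 z2 0 b1 b2; rewrite ?addr0.
Qed.

Lemma dyadic_derivative_induced : induced_by Omega d F.
Proof.
apply: tangent_function_induced => //.
- exact: dyadic_derivative_pseudo_norm_function.
- exact: dyadic_derivative_tangent.
- exact: local_norm_bounds_bounded.
Qed.

End BoundsToPseudoNorm.

(** * Metrics induced by a Lipschitz pseudo-norm function *)

Section UnitIntervalIntegral.
Context {R : realType}.
Local Notation mu := (@lebesgue_measure R).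
Implicit Types f g : R -> R.

Lemma integral01_cst (K : R) : \int[mu]_(t in `[0, 1]) K = K.
Proof.
rewrite Rintegral_cst//= lebesgue_measure_itv /= lte_fin ltr01.
by rewrite sube0 /= mulr1.
Qed.

Lemma integral01_leD f g K :
  (forall t, 0 <= t <= 1 -> {for t, continuous f}) ->
  (forall t, 0 <= t <= 1 -> {for t, continuous g}) ->
  (forall t, 0 <= t <= 1 -> f t <= g t + K) ->
  \int[mu]_(t in `[0, 1]) f t <= \int[mu]_(t in `[0, 1]) g t + K.
Proof.
move=> cf cg fg; rewrite -[X in _ + X]integral01_cst -RintegralD//.
- apply: le_Rintegral => //.
  + exact: continuous_itv_integrable.
  + apply: (@continuous_itv_integrable _ (fun t => g t + K)) => t t01.
    by apply: cvgD; [exact: cg | exact: cvg_cst].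
- exact: continuous_itv_integrable.
- by apply: (@continuous_itv_integrable _ (cst K)) => t t01; exact: cvg_cst.
Qed.

End UnitIntervalIntegral.

Section InducedTangent.
Context {R : realType} {n : nat}.
Local Notation V := 'rV[R]_n.
Local Notation mu := (@lebesgue_measure R).

Lemma pseudo_norm_equiv (f : V -> R) : pseudo_norm f -> continuous f ->
  exists m M, [/\ 0 < m, 0 < M & forall y, m * `|y| <= f y <= M * `|y|].
Proof.
move=> pf cf; pose S := [set y : V | `|y| = 1].
have f0 : f 0 = 0 by apply/(pn_eq0 pf).
have scal y : y != 0 -> S (`|y|^-1 *: y) /\ f y = `|y| * f (`|y|^-1 *: y).
  move=> y0; have ny : 0 < `|y| by rewrite normr_gt0.
  split; last by rewrite -(pn_homog pf)// scalerKV// gt_eqF.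
  by rewrite /S /= normrZ normfV normr_id mulVf// gt_eqF.
(* An empty unit sphere means that the space is trivial, and any positive constants do. *)
have [S0|S0] := pselect (S !=set0); last first.
  exists 1, 1; split=> // y; have [->|y0] := eqVneq y 0.
    by rewrite normr0 f0 mulr0 lexx.
  by case: S0; exists (`|y|^-1 *: y); have [] := scal y y0.
have cS : compact S.
  apply: bounded_closed_compact.
    by exists 1; split=> // x x1 y /= ->; exact: ltW.
  have -> : S = (fun y : V => `|y|) @^-1` [set 1] by [].
  by apply: preimage_closed => // y _; exact: norm_continuous.
have cfS : {within S, continuous f} by exact: continuous_subspaceT.
have [y1 S1 H1] := compact_EVT_max S0 cS cfS.
have [y2 S2 H2] := compact_EVT_min S0 cS cfS.
have pos y : S y -> 0 < f y.
  move=> Sy; rewrite lt_neqAle (pn_ge0 pf) andbT; apply/eqP => fy.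
  have y0 : y = 0 by apply/(pn_eq0 pf).
  by move: Sy; rewrite y0 /S /= normr0 => /eqP; rewrite eq_sym oner_eq0.
move: S1 S2 => /set_mem S1 /set_mem S2.
exists (f y2), (f y1); split; [exact: pos|exact: pos|] => y.
have [->|y0] := eqVneq y 0; first by rewrite normr0 f0 !mulr0 lexx.
have [Sy ->] := scal y y0.
have Sy' := mem_set Sy.
by rewrite ![_ * `|y|]mulrC !ler_wpM2l ?normr_ge0 ?H1 ?H2.
Qed.

Variables (Omega : set V) (d F : V -> V -> R).
Hypotheses (cO : convex_domain Omega) (pF : pseudo_norm_function Omega F)
  (lF : lipschitz_pseudo_norm_function Omega F) (iF : induced_by Omega d F).

Let oO : open Omega. Proof. by case: cO. Qed.

Let cF x y : Omega x -> {for (x, y), continuous (fun p : V * V => F p.1 p.2)}.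
Proof. by move=> Ox; exact (@pseudo_norm_function_continuous _ _ Omega F x y oO pF Ox). Qed.

Let Fpn x : Omega x -> pseudo_norm (F x). Proof. exact: (pnf_pseudo_norm pF). Qed.

Let cFr x : Omega x -> continuous (F x).
Proof.
move=> Ox y.
apply: (@continuous2_cvg _ _ _ _ (nbhs y) _ (cst x) id F x y).
- exact: cF.
- exact: cvg_cst.
- exact: cvg_id.
Qed.

Lemma pseudo_norm_function_local x : Omega x -> exists r m M C,
  [/\ 0 < r, 0 < m, 0 < M, 0 < C & ball x r `<=` Omega] /\
  (forall z y, ball x r z -> m * `|y| <= F z y <= M * `|y|) /\
  (forall z1 z2 y, ball x r z1 -> ball x r z2 ->
    `|F z1 y - F z2 y| <= C * `|y| * `|z1 - z2|).
Proof.
move=> Ox; have [U [C0 [nU UO C00 HU]]] := lF Ox.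
have [m [M [m0 M0 HmM]]] := pseudo_norm_equiv (Fpn Ox) (@cFr x Ox).
have /nbhs_ballP[r /= r0 rU] := nU.
set N : R := n.+1%:R; have N0 : 0 < N by [].
pose C := C0 * N ^+ 2.
have C_gt0 : 0 < C by rewrite mulr_gt0// exprn_gt0.
have HC z1 z2 y : ball x r z1 -> ball x r z2 ->
    `|F z1 y - F z2 y| <= C * `|y| * `|z1 - z2|.
  move=> /rU U1 /rU U2; apply: le_trans (HU _ _ y U1 U2) _.
  have -> : C * `|y| * `|z1 - z2| = (C0 * (N * `|y|)) * (N * `|z1 - z2|).
    by rewrite /C; ring.
  apply: ler_pM; rewrite ?enorm_ge0 ?mulr_ge0 ?enorm_ge0 ?(ltW C00)//.
    by rewrite ler_pM2l// enorm_le_norm.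
  exact: enorm_le_norm.
(* Within m / 2 / C of x the Lipschitz bound lets F vary by at most (m / 2) |y|, which turns the
   constants m, M at x into m / 2, M + m / 2. *)
pose q := Num.min r (m / 2 / C).
have q0 : 0 < q by rewrite lt_min r0 !divr_gt0.
have qr : ball x q `<=` ball x r by apply: le_ball; rewrite ge_min lexx.
exists q, (m / 2), (M + m / 2), C; split.
  split=> //; rewrite ?divr_gt0 ?addr_gt0 ?divr_gt0//.
  exact: subset_trans qr (subset_trans rU UO).
split=> [z y bz|z1 z2 y b1 b2]; last by apply: HC; exact: qr.
have H := HC _ _ y (ballxx x r0) (qr _ bz).
have xz : C * `|y| * `|x - z| <= m / 2 * `|y|.
  have : `|x - z| <= m / 2 / C.
    apply: ltW; move: bz; rewrite -ball_normE /ball_ /= => /lt_le_trans; apply.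
    by rewrite ge_min lexx orbT.
  by rewrite ler_pdivlMr// => h; rewrite mulrAC ler_wpM2r// mulrC.
have {xz}H := le_trans H xz.
have /andP[h1 h2] := HmM y.
by move: H; rewrite ler_norml => /andP[h3 h4]; apply/andP; split; lra.
Qed.

Lemma induced_le x1 x2 c : Omega x1 -> Omega x2 -> admissible_curve Omega x1 x2 c ->
  d x1 x2 <= \int[mu]_(t in `[0, 1]) F (c t) (derive1 c t).
Proof.
move=> O1 O2 ac; rewrite iF//; apply: ge_inf; last by exists c.
exists 0 => _ [c' ac' <-]; apply: Rintegral_ge0 => t /=; rewrite in_itv /= => t01.
by apply: (pn_ge0 (Fpn _)); exact: (ac_sub ac').
Qed.

Lemma segment_integrand_continuous x1 x2 v t : Omega (segment x1 x2 t) ->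
  {for t, continuous (fun u => F (segment x1 x2 u) v)}.
Proof.
move=> Ot; have cv : {for t, continuous (cst v : R -> V)} by exact: cvg_cst.
have cs : {for t, continuous (segment x1 x2)}.
  by apply: derivable1_continuous; case: (is_derive_segment x1 x2 t).
exact: (continuous_along cF Ot cs cv).
Qed.

Lemma induced_le_segment x1 x2 : Omega x1 -> Omega x2 ->
  d x1 x2 <= \int[mu]_(t in `[0, 1]) F (segment x1 x2 t) (x2 - x1).
Proof.
move=> O1 O2; have := induced_le O1 O2 (admissible_segment cO O1 O2).
by under eq_Rintegral do rewrite derive1_segment.
Qed.

Lemma induced_le_cst x1 x2 K : Omega x1 -> Omega x2 ->
  (forall t, 0 <= t <= 1 -> F (segment x1 x2 t) (x2 - x1) <= K) -> d x1 x2 <= K.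
Proof.
move=> O1 O2 FK; apply: le_trans (induced_le_segment O1 O2) _.
rewrite -[leRHS]add0r -[X in _ <= X + _](integral01_cst 0).
apply: integral01_leD => [t t01|t t01|t t01]; last by rewrite add0r FK.
  by apply: segment_integrand_continuous; exact: convex_segment.
exact: cvg_cst.
Qed.

(* Truncating rho z = N (z - x1) at m makes the comparison local: outside {N (z - x1) <= m}
   rho is constant, so curves leaving that set are harmless. *)
Lemma induced_ge (N : V -> R) m x1 x2 : Omega x1 -> Omega x2 ->
  pseudo_norm N -> continuous N ->
  (forall z y, Omega z -> N (z - x1) <= m -> N y <= F z y) -> 0 <= m ->
  Num.min (N (x2 - x1)) m <= d x1 x2.
Proof.
move=> O1 O2 pN cN NF m0; pose rho (z : V) := Num.min (N (z - x1)) m.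
have N0 : N 0 = 0 by apply/(pn_eq0 pN).
have rho1 : rho x1 = 0 by rewrite /rho subrr N0; apply/min_idPl.
rewrite iF//; apply: lb_le_inf.
  by eexists; exists (segment x1 x2) => //; exact: admissible_segment.
move=> _ [c ac <-]; have -> : Num.min (N (x2 - x1)) m = rho x2 - rho x1 by rewrite rho1 subr0.
apply: (@admissible_growth _ _ Omega F cF rho _ _ _ _ _ ac).
  move=> x Ox.
  have cNx : {for x, continuous (fun z : V => N (z - x1))}.
    apply: (@continuous_comp _ _ _ (fun z : V => z - x1) N); last exact: cN.
    by apply: (@cvgB _ _ _ (nbhs x) _ id (cst x1) x x1); [exact: cvg_id|exact: cvg_cst].
  have cm : {for x, continuous (cst m : V -> R)} by exact: cst_continuous.
  exact: (continuous_min cNx cm).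
move=> x y e Ox e0.
have Ny : \forall w \near y, N w <= N y + e.
  by apply: (cvgr_le _ (cN y)); rewrite ltrDl.
near=> s w => /=.
have s0 : 0 < s by near: s; exact: nbhs_right_gt.
have [h|h] := leP (N (x - x1)) m; last first.
  apply: (@le_trans _ _ 0); last first.
    by rewrite mulr_ge0 ?(ltW s0)// addr_ge0 ?(ltW e0)// (pn_ge0 (Fpn Ox)).
  by rewrite subr_le0 /rho (min_idPr (ltW h)) ge_min lexx orbT.
have -> : rho x = N (x - x1) by exact/min_idPl.
rewrite lerBlDl; apply: (@le_trans _ _ (N (x + s *: w - x1))).
  by rewrite /rho ge_min lexx.
have -> : x + s *: w - x1 = (x - x1) + s *: w by rewrite addrAC.
apply: le_trans (pn_subadd pN _ _) _; rewrite lerD2l (pn_homog pN)// ler_pM2l//.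
apply: (@le_trans _ _ (N y + e)); first by near: w.
by rewrite lerD2r; exact: NF.
Unshelve. all: by end_near. Qed.

Lemma ball_segment (x x1 x2 : V) r t : 0 <= t <= 1 -> ball x r x1 -> ball x r x2 ->
  ball x r (segment x1 x2 t).
Proof.
move=> /andP[t0 t1]; rewrite -!ball_normE /ball_ /= => b1 b2.
have -> : x - segment x1 x2 t = (1 - t) *: (x - x1) + t *: (x - x2).
  by apply/matrixP => i j; rewrite !mxE; ring.
apply: le_lt_trans (ler_normD _ _) _; rewrite !normrZ (ger0_norm t0) ger0_norm ?subr_ge0//.
have [->|tn0] := eqVneq t 0; first by rewrite subr0 mul1r mul0r addr0.
have -> : r = (1 - t) * r + t * r by ring.
apply: ler_ltD; first by rewrite ler_wpM2l ?subr_ge0// ltW.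
by rewrite ltr_pM2l// lt_neqAle eq_sym tn0.
Qed.

Lemma induced_bounded : locally_bounded_by_norm Omega d.
Proof.
move=> x Ox; have [r [m [M [C [[r0 m0 M0 C0 rO] [HmM _]]]]]] := pseudo_norm_function_local Ox.
exists M => //; exists (ball x r, ball x r) => /=; first by split; exact: nbhsx_ballx.
move=> [z1 z2] /= [b1 b2]; apply: induced_le_cst; [exact: rO|exact: rO|] => t t01.
by have /andP[] := HmM _ (z2 - z1) (ball_segment t01 b1 b2).
Qed.

(** From above, the segment from x to x + s v has length at most s F x v + C s^2 |v|^2. From below,
    [induced_ge] is used with the slightly reduced norm (1 - s A) F x, which F dominates wherever
    the truncation is not active. *)
Lemma induced_tangent : tangent_function Omega d F.
Proof.
move=> x v e Ox e0.
have [r [m [M [C [[r0 m0 M0 C0 rO] [HmM HC]]]]]] := pseudo_norm_function_local Ox.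
have bx : ball x r x by exact: ballxx.
(* Where the truncation is inactive, |z - x| <= s M |v| / m. So F z y falls below F x y by at most C
   |y| s M |v| / m, and |y| <= F x y / m turns this into s A F x y. *)
pose A := C * M * `|v| / m ^+ 2.
have A0 : 0 <= A by rewrite /A divr_ge0 ?exprn_ge0 ?mulr_ge0// ltW.
(* The coefficients of s^2 in the upper and lower errors, the latter through F x v <= M |v|. *)
pose B := C * `|v| ^+ 2 + A * M * `|v|.
have CV0 : 0 <= C * `|v| ^+ 2 by rewrite mulr_ge0 ?exprn_ge0// ltW.
have AM0 : 0 <= A * M * `|v| by rewrite mulr_ge0// mulr_ge0// ltW.
have v1 : 0 < `|v| + 1 by rewrite ltr_wpDl.
have Mv1 : 0 < M * `|v| / m + 1 by rewrite ltr_wpDl// divr_ge0 ?mulr_ge0// ltW.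
have A1 : 0 < A + 1 by rewrite ltr_wpDl.
have B1 : 0 < B + 1 by rewrite ltr_wpDl// addr_ge0.
near=> s.
have s0 : 0 < s by near: s; exact: nbhs_right_gt.
have sv : s * `|v| < r.
  apply: (@le_lt_trans _ _ (s * (`|v| + 1))); first by rewrite ler_pM2l// lerDl.
  by rewrite -ltr_pdivlMr//; near: s; apply: nbhs_right_lt; exact: divr_gt0.
have sMv : s * (M * `|v| / m) < r.
  apply: (@le_lt_trans _ _ (s * (M * `|v| / m + 1))); first by rewrite ler_pM2l// lerDl.
  by rewrite -ltr_pdivlMr//; near: s; apply: nbhs_right_lt; exact: divr_gt0.
have sA : s * A < 1.
  apply: (@le_lt_trans _ _ (s * (A + 1))); first by rewrite ler_pM2l// lerDl.
  by rewrite -ltr_pdivlMr//; near: s; apply: nbhs_right_lt; exact: divr_gt0.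
have sB : s * B <= e.
  apply: (@le_trans _ _ (s * (B + 1))); first by rewrite ler_pM2l// lerDl.
  by rewrite -ler_pdivlMr//; near: s; apply: nbhs_right_le; exact: divr_gt0.
have nsv : `|s *: v| = s * `|v| by rewrite normrZ gtr0_norm.
have bs : ball x r (x + s *: v).
  by rewrite -ball_normE /ball_ /= opprD addrA subrr add0r normrN nsv.
have Os := rO _ bs.
have Fs : F x (s *: v) = s * F x v := pn_homog (Fpn Ox) v s0.
have /andP[_ FM] := HmM _ v bx.
have F0 : 0 <= F x v := pn_ge0 (Fpn Ox) v.
have upper : d x (x + s *: v) <= s * F x v + C * (s * `|v|) * (s * `|v|).
  apply: induced_le_cst => // t t01; rewrite [x + _ - x]addrC addKr.
  have bt := ball_segment t01 bx bs.
  have := HC _ _ (s *: v) bt bx; rewrite ler_norml nsv => /andP[_].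
  rewrite lerBlDl Fs => h.
  apply: le_trans h _; rewrite lerD2l; apply: ler_wpM2l; first by rewrite !mulr_ge0// ltW.
  have -> : segment x (x + s *: v) t - x = t *: (s *: v).
    by rewrite /segment [x + s *: v - x]addrC addKr addrC addKr.
  have /andP[t0 t1] := t01.
  by rewrite normrZ (ger0_norm t0) nsv ler_piMl// mulr_ge0// ltW.
pose N y := (1 - s * A) * F x y.
have a0 : 0 < 1 - s * A by rewrite subr_gt0.
have pN : pseudo_norm N.
  have pFx := Fpn Ox; split; rewrite /N.
  - by move=> y; rewrite mulr_ge0 ?(ltW a0)// (pn_ge0 pFx).
  - move=> y; rewrite -(pn_eq0 pFx); split=> [/eqP|->]; last by rewrite mulr0.
    by rewrite mulf_eq0 (gt_eqF a0) => /eqP.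
  - by move=> a y a_gt0; rewrite (pn_homog pFx)//; ring.
  - by move=> y1 y2; rewrite -mulrDr ler_pM2l// (pn_subadd pFx).
have cN : continuous N.
  move=> y; apply: (@cvgM _ _ (nbhs y) _ (cst (1 - s * A)) (F x)); first exact: cvg_cst.
  exact: cFr.
have lower : (1 - s * A) * (s * F x v) <= d x (x + s *: v).
  (* Truncating exactly at the value at the endpoint x + s v keeps the comparison region as small as
     possible without losing anything in the minimum. *)
  have -> : (1 - s * A) * (s * F x v) = Num.min (N (x + s *: v - x)) (N (s *: v)).
    by rewrite [x + _ - x]addrC addKr minxx /N Fs.
  apply: induced_ge => //; last exact: (pn_ge0 pN).
  move=> z y Oz; rewrite /N ler_pM2l// Fs => h.
  have mz : m * `|z - x| <= s * (M * `|v|).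
    have /andP[h1 _] := HmM _ (z - x) bx.
    by apply: le_trans h1 _; apply: le_trans h _; rewrite ler_pM2l.
  have zx : `|z - x| <= s * (M * `|v|) / m by rewrite ler_pdivlMr// mulrC.
  have bz : ball x r z.
    rewrite -ball_normE /ball_ /= distrC; apply: le_lt_trans zx _.
    by rewrite -mulrA.
  have /andP[hy _] := HmM _ y bx.
  have {}hy : `|y| <= F x y / m by rewrite ler_pdivlMr// mulrC.
  have := HC _ _ y bx bz; rewrite [`|x - z|]distrC ler_norml => /andP[_ H].
  have {}H : F x y - C * `|y| * `|z - x| <= F z y by lra.
  apply: le_trans H.
  have -> : (1 - s * A) * F x y = F x y - C * (F x y / m) * (s * (M * `|v|) / m).
    by rewrite /A; field; rewrite gt_eqF.
  rewrite lerD2l lerN2; apply: ler_pM => //; first by rewrite mulr_ge0// ltW.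
  by rewrite ler_pM2l.
rewrite ler_norml; apply/andP; split.
  rewrite lerBrDr; apply: le_trans lower.
  have -> : (1 - s * A) * (s * F x v) = - ((s * (A * F x v)) * s) + s * F x v by ring.
  rewrite lerD2r lerN2 ler_pM2r//; apply: le_trans sB; rewrite ler_pM2l//.
  by rewrite /B -mulrA (le_trans (ler_wpM2l A0 FM))// lerDr.
rewrite lerBlDl; apply: le_trans upper _; rewrite lerD2l.
have -> : C * (s * `|v|) * (s * `|v|) = s * (C * `|v| ^+ 2) * s by ring.
rewrite ler_pM2r//; apply: le_trans sB; rewrite ler_pM2l//.
by rewrite /B lerDl.
Unshelve. all: by end_near. Qed.

Hypotheses (md : asymmetric_metric Omega d) (fd : projectively_flat Omega d).

(** The Lipschitz bound compares the integral formula on two parallel segments. The lower bound is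
    [induced_ge] for the multiple m of the norm, the upper one integrates along the segment. *)
Lemma induced_local_bounds x : Omega x -> exists r c C, local_norm_bounds Omega d x r c C.
Proof.
move=> Ox; have [r [m [M [C [[r0 m0 M0 C0 rO] [HmM HC]]]]]] := pseudo_norm_function_local Ox.
(* Points within r / 6 of x are at most r / 3 apart, so truncation at m r / 3 leaves m |x2 - x1|
   intact; points within r / 3 of x1 stay within r / 2 of x, where the bounds on F hold. *)
have r6 : 0 < r / 6 by rewrite divr_gt0.
have b6 : ball x (r / 6) `<=` ball x r.
  by apply: le_ball; rewrite ler_pdivrMr// ler_peMr ?ler1n// ltW.
exists (r / 6), m, (M + C); split=> //; first exact: addr_gt0.
  exact: subset_trans b6 rO.
move=> x1 x2 y b1 b2 b3 b4.
have [u1 u2 u3 u4] : [/\ Omega x1, Omega x2, Omega (x1 + y) & Omega (x2 + y)].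
  by split; apply/rO/b6.
have seg_int z : Omega z -> Omega (z + y) -> d z (z + y) =
    \int[mu]_(t in `[0, 1]) F (segment z (z + y) t) y.
  move=> Oz Ozy.
  rewrite (metric_segment_integral cO md fd pF induced_tangent induced_bounded)//.
  by rewrite [z + y - z]addrC addKr.
(* At every time the two segments differ by the constant vector z1 - z2. The one-sided form is used
   twice, with the roles exchanged. *)
have diff z1 z2 : ball x (r / 6) z1 -> ball x (r / 6) z2 ->
    ball x (r / 6) (z1 + y) -> ball x (r / 6) (z2 + y) ->
    d z1 (z1 + y) <= d z2 (z2 + y) + C * `|y| * `|z1 - z2|.
  move=> /b6 c1 /b6 c2 /b6 c3 /b6 c4.
  rewrite !seg_int; try exact: rO.
  apply: integral01_leD => t t01.
  - by apply: segment_integrand_continuous; apply: convex_segment => //; exact: rO.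
  - by apply: segment_integrand_continuous; apply: convex_segment => //; exact: rO.
  have := HC _ _ y (ball_segment t01 c1 c3) (ball_segment t01 c2 c4).
  have -> : segment z1 (z1 + y) t - segment z2 (z2 + y) t = z1 - z2.
    by apply/matrixP => i j; rewrite !mxE; ring.
  by rewrite ler_norml => /andP[_]; rewrite lerBlDl.
split; last first.
  have d12 := diff _ _ b1 b2 b3 b4; have d21 := diff _ _ b2 b1 b4 b3.
  rewrite [`|x1 - x2|]distrC in d12.
  have : C * `|y| * `|x2 - x1| <= (M + C) * `|y| * `|x2 - x1|.
    by rewrite -!mulrA ler_wpM2r ?mulr_ge0// lerDr ltW.
  by rewrite ler_norml => ?; apply/andP; split; lra.
apply/andP; split; last first.
  apply: induced_le_cst => // t t01.
  have /andP[_ h] := HmM _ (x2 - x1) (ball_segment t01 (b6 _ b1) (b6 _ b2)).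
  by apply: le_trans h _; rewrite ler_wpM2r// lerDl ltW.
pose N (z : V) := m * `|z|.
have pN : pseudo_norm N.
  split; rewrite /N.
  - by move=> z; rewrite mulr_ge0// ltW.
  - move=> z; split=> [/eqP|->]; last by rewrite normr0 mulr0.
    by rewrite mulf_eq0 (gt_eqF m0)/= normr_eq0 => /eqP.
  - by move=> a z a0; rewrite normrZ (gtr0_norm a0); ring.
  - by move=> z1 z2; rewrite -mulrDr ler_pM2l// ler_normD.
have cN : continuous N.
  move=> z; apply: (@cvgM _ _ (nbhs z) _ (cst m) (fun u : V => `|u|)).
    exact: cvg_cst.
  exact: norm_continuous.
have x12 : `|x2 - x1| <= r / 3.
  move: b1 b2; rewrite -!ball_normE /ball_ /= => b1 b2.
  have -> : x2 - x1 = (x - x1) - (x - x2) by apply/matrixP => i j; rewrite !mxE; ring.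
  by apply: le_trans (ler_normB _ _) _; lra.
have NF z u : Omega z -> N (z - x1) <= m * (r / 3) -> N u <= F z u.
  move=> Oz; rewrite /N ler_pM2l// => h.
  have bz : ball x r z.
    move: b1; rewrite -!ball_normE /ball_ /= => b1.
    have -> : x - z = (x - x1) - (z - x1) by apply/matrixP => i j; rewrite !mxE; ring.
    by apply: le_lt_trans (ler_normB _ _) _; lra.
  by have /andP[] := HmM _ u bz.
have := @induced_ge N (m * (r / 3)) x1 x2 u1 u2 pN cN NF.
have -> : Num.min (N (x2 - x1)) (m * (r / 3)) = m * `|x2 - x1|.
  by apply/min_idPl; rewrite /N ler_pM2l.
by apply; rewrite mulr_ge0 ?(ltW m0)// divr_ge0// ltW.
Qed.

End InducedTangent.

(** * Functions of class C^k *)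

Section CkCalculus.
Context {R : realType}.

Section General.
Context {V W : normedModType R}.
Implicit Types (A B : set V) (f g : V -> W).

Lemma Ck_on_continuous k A f x : Ck_on k A f -> A x -> {for x, continuous f}.
Proof. by case: k => [|k] [cf _]; exact: cf. Qed.

Lemma Ck_on_derivable k A f x : Ck_on k.+1 A f -> A x -> forall v, derivable f x v.
Proof. by move=> [_ df] Ax v; exact: (df v).1. Qed.
#[global] Arguments Ck_on_derivable {k A f x} _ _ _.

Lemma Ck_on_derive k A f : Ck_on k.+1 A f -> forall v, Ck_on k A ('D_v f).
Proof. by move=> [_ df] v; exact: (df v).2. Qed.
#[global] Arguments Ck_on_derive {k A f} _ _.

Lemma Ck_onW k A f : Ck_on k.+1 A f -> Ck_on k A f.
Proof.
elim: k f => [|k IHk] f fA; first by split=> //; case: fA.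
split=> [x Ax|v]; first exact: Ck_on_continuous fA Ax.
split=> [x Ax|]; first exact: (Ck_on_derivable fA).
by apply: IHk; exact: Ck_on_derive.
Qed.

Lemma near_eq_continuous f g x :
  (\forall y \near x, f y = g y) -> {for x, continuous f} -> {for x, continuous g}.
Proof.
move=> fg cf; have fgx := nbhs_singleton fg.
suff : g y @[y --> x] --> g x by [].
by rewrite -fgx; apply: cvg_trans cf; exact: near_eq_cvg.
Qed.

Lemma Ck_on_eq k A f g : open A -> (forall x, A x -> f x = g x) ->
  Ck_on k A f -> Ck_on k A g.
Proof.
move=> oA; elim: k f g => [|k IHk] f g fg [cf df].
  split=> // x Ax; apply: near_eq_continuous (cf x Ax).
  by apply: filterS (open_nbhs_nbhs (conj oA Ax)).
have nfg x : A x -> \forall y \near x, f y = g y.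
  by move=> Ax; apply: filterS (open_nbhs_nbhs (conj oA Ax)).
split=> [x Ax|v]; first exact: near_eq_continuous (nfg x Ax) (cf x Ax).
have [dv Dv] := df v; split=> [x Ax|].
  exact: near_eq_derivable (nfg x Ax) (dv x Ax).
apply: IHk Dv => x Ax; exact: near_eq_derive (nfg x Ax).
Qed.

(** Used for the smoothness of F, which is represented by a formula valid only near a given
    point. *)
Lemma Ck_on_local k A f :
  (forall x, A x -> exists2 B, B x & Ck_on k B f) -> Ck_on k A f.
Proof.
elim: k f => [|k IHk] f H.
  by split=> // x /H[B Bx [cf _]]; exact: cf.
split=> [x /H[B Bx [cf _]]|v]; first exact: cf.
split=> [x /H[B Bx fB]|]; first exact: (Ck_on_derivable fB Bx).
by apply: IHk => x /H[B Bx fB]; exists B => //; exact: Ck_on_derive.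
Qed.

Lemma Ck_on_add k A f g : open A -> Ck_on k A f -> Ck_on k A g ->
  Ck_on k A (fun x => f x + g x).
Proof.
move=> oA; elim: k f g => [|k IHk] f g fA gA.
  by split=> // x Ax; apply: cvgD; [exact: Ck_on_continuous fA Ax | exact: Ck_on_continuous gA Ax].
split=> [x Ax|v].
  by apply: cvgD; [exact: Ck_on_continuous fA Ax | exact: Ck_on_continuous gA Ax].
have df x (Ax : A x) := Ck_on_derivable fA Ax v.
have dg x (Ax : A x) := Ck_on_derivable gA Ax v.
split=> [x Ax|]; first by apply: derivableD; [exact: df | exact: dg].
apply: (@Ck_on_eq _ _ (fun x => 'D_v f x + 'D_v g x)) => //.
  by move=> x Ax; rewrite deriveD//; [exact: df | exact: dg].
by apply: IHk; exact: Ck_on_derive.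
Qed.

Lemma Ck_on_scale k A f (a : R) : open A -> Ck_on k A f ->
  Ck_on k A (fun x => a *: f x).
Proof.
move=> oA; elim: k f => [|k IHk] f fA.
  split=> // x Ax; apply: cvgZ; first exact: cvg_cst.
  exact: Ck_on_continuous fA Ax.
split=> [x Ax|v].
  apply: cvgZ; first exact: cvg_cst.
  exact: Ck_on_continuous fA Ax.
have df x (Ax : A x) := Ck_on_derivable fA Ax v.
split=> [x Ax|]; first by apply: derivableZ; exact: df.
apply: (@Ck_on_eq _ _ (fun x => a *: 'D_v f x)) => //.
  by move=> x Ax; rewrite deriveZ//; exact: df.
by apply: IHk; exact: Ck_on_derive.
Qed.

Lemma Ck_on_sum k A m (f : 'I_m -> V -> W) : open A ->
  (forall i, Ck_on k A (f i)) -> Ck_on k A (fun x => \sum_i f i x).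
Proof.
move=> oA; elim: m f => [|m IHm] f fA.
  have C0 j : Ck_on j A (cst 0 : V -> W).
    elim: j => [|j IHj]; first by split=> // x _; exact: cvg_cst.
    split=> [x _|v]; first exact: cvg_cst.
    split=> [x _|]; first exact: derivable_cst.
    by apply: Ck_on_eq IHj => // x _; rewrite derive_cst.
  by apply: Ck_on_eq (C0 k) => // x _; rewrite big_ord0.
apply: (@Ck_on_eq _ _ (fun x => \sum_(i < m) f (widen_ord (leqnSn m) i) x + f ord_max x)) => //.
  by move=> x _; rewrite big_ord_recr.
by apply: Ck_on_add => //; exact: IHm.
Qed.

End General.

Lemma derive_comp_line (V W : normedModType R) (f : V -> W) x v (s : R) :
  (derivable f (x + s *: v) v -> derivable (fun u : R => f (x + u *: v)) s 1) /\
  'D_1 (fun u : R => f (x + u *: v)) s = 'D_v f (x + s *: v).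
Proof.
have E : (fun h : R => h^-1 *: (((fun u : R => f (x + u *: v)) \o shift s) (h *: 1) -
     f (x + s *: v))) =
   (fun h => h^-1 *: ((f \o shift (x + s *: v)) (h *: v) - f (x + s *: v))).
  apply/funext => h /=; congr (_ *: (f _ - _)).
  by rewrite [h *: 1]mulr1 scalerDl addrCA.
by rewrite /derivable /derive E.
Qed.

Lemma mean_value_line (V : normedModType R) (f : V -> R^o) x v (h : R) :
  (forall s, `|s| <= `|h| -> derivable f (x + s *: v) v) ->
  exists2 s, `|s| <= `|h| & f (x + h *: v) - f x = h * 'D_v f (x + s *: v).
Proof.
move=> df; pose g (u : R) : R^o := f (x + u *: v).
have dg (s : R) : `|s| <= `|h| -> is_derive s 1 g ('D_v f (x + s *: v)).
  by move=> /df dfs; have [H <-] := derive_comp_line f x v s; apply: DeriveDef; [exact: H | exact: erefl].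
have cg (a b : R) : (forall s : R, a <= s <= b -> `|s| <= `|h|) -> {within `[a, b], continuous g}.
  move=> H; apply: derivable_within_continuous => s; rewrite in_itv /= => /H/dg[].
  by [].
have g0 : g 0 = f x by rewrite /g scale0r addr0.
have [h0|h0] := leP 0 h.
  have H s : 0 <= s <= h -> `|s| <= `|h|.
    by move=> /andP[s0 sh]; rewrite !ger0_norm.
  have [|s] := @MVT_segment R g (fun s => 'D_v f (x + s *: v)) 0 h h0 _ (cg _ _ H).
    by move=> s; rewrite in_itv /= => /andP[s0 sh]; apply/dg/H; rewrite !ltW.
  rewrite in_itv /= => /H sh E; exists s => //.
  by rewrite -g0 -/(g h) E subr0 mulrC.
have H s : h <= s <= 0 -> `|s| <= `|h|.
  by move=> /andP[s0 sh]; rewrite !ler0_norm ?lerN2// ltW.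
have [|s] := @MVT_segment R g (fun s => 'D_v f (x + s *: v)) h 0 (ltW h0) _ (cg _ _ H).
  by move=> s; rewrite in_itv /= => /andP[s0 sh]; apply/dg/H; rewrite !ltW.
rewrite in_itv /= => /H sh E; exists s => //.
by rewrite -g0 -/(g h) -opprB E sub0r mulrN opprK mulrC.
Qed.

(** The intermediate points of mean value theorems are unknown, so all steps bounded by |h|, in two
    directions independently, are covered at once. *)
Lemma near_line (V : normedModType R) (x v w : V) (P : set V) :
  (\forall y \near x, P y) ->
  \forall h \near (0 : R), forall s r, `|s| <= `|h| -> `|r| <= `|h| ->
    P (x + s *: v + r *: w).
Proof.
move=> /nbhs_ballP[e /= e0 eP].
have c0 : 0 < `|v| + `|w| + 1 by rewrite ltr_wpDl// addr_ge0.
apply/nbhs_ballP; exists (e / (`|v| + `|w| + 1)); first by rewrite /= divr_gt0.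
move=> h; rewrite /ball /= sub0r normrN ltr_pdivlMr// => he s r sh rh.
apply: eP; rewrite -ball_normE /ball_ /=.
rewrite -addrA opprD addrA subrr add0r normrN.
apply: le_lt_trans (ler_normD _ _) _; rewrite !normrZ; apply: le_lt_trans he.
rewrite -addrA mulrDr; apply: lerD; first by rewrite ler_wpM2r.
by rewrite mulrDr -[leLHS]addr0; apply: lerD; [rewrite ler_wpM2r | rewrite mulr1].
Qed.

Lemma is_derive_scale (V W : normedModType R) (f : V -> W) x v l (a : R) :
  is_derive x v f l -> is_derive x (a *: v) f (a *: l).
Proof.
move=> /is_derive_epsP df; apply/is_derive_epsP => e e0.
have a1 : 0 < `|a| + 1 by rewrite ltr_wpDl.
have ca : h * a @[h --> (0 : R)] --> (0 : R).
  rewrite -[X in _ --> X](mul0r a).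
  by apply: (@cvgM _ _ (nbhs (0 : R)) _ id (cst a)); [exact: cvg_id | exact: cvg_cst].
have H0 : \forall h \near (0 : R), `|f (x + (h * a) *: v) - f x - (h * a) *: l| <=
    e / (`|a| + 1) * `|h * a| := ca _ (df _ (divr_gt0 e0 a1)).
apply: filterS H0 => h; rewrite !scalerA => H.
apply: le_trans H _; rewrite normrM.
have -> : e / (`|a| + 1) * (`|h| * `|a|) = e * `|h| * (`|a| / (`|a| + 1)) by ring.
by rewrite ler_piMr ?mulr_ge0 ?(ltW e0)// ler_pdivrMr// mul1r lerDl.
Qed.

(** Move first along v, then along w: the mean value theorem on each leg and continuity of the two
    derivatives at x give the sum. *)
Lemma is_derive_C1_add (V : normedModType R) (A : set V) (f : V -> R^o) x v w :
  open A -> Ck_on 1 A f -> A x ->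
  is_derive x (v + w) f ('D_v f x + 'D_w f x).
Proof.
move=> oA fA Ax; apply/is_derive_epsP => e e0.
have e2 : 0 < e / 2 by rewrite divr_gt0.
have nA : \forall y \near x, A y by exact: open_nbhs_nbhs.
have nv : \forall y \near x, `|'D_v f x - 'D_v f y| <= e / 2.
  by apply: cvgr_dist_le (Ck_on_continuous (Ck_on_derive fA v) Ax) _ e2.
have nw : \forall y \near x, `|'D_w f x - 'D_w f y| <= e / 2.
  by apply: cvgr_dist_le (Ck_on_continuous (Ck_on_derive fA w) Ax) _ e2.
apply: filterS (near_line v w (filterI nA (filterI nv nw))) => h H.
have Hv s : `|s| <= `|h| -> A (x + s *: v) /\ `|'D_v f x - 'D_v f (x + s *: v)| <= e / 2.
  move=> sh; have [|B1 [B2 _]] := H s 0 sh; first by rewrite normr0.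
  by move: B1 B2; rewrite scale0r addr0.
have Hw s : `|s| <= `|h| ->
    A (x + h *: v + s *: w) /\ `|'D_w f x - 'D_w f (x + h *: v + s *: w)| <= e / 2.
  by move=> sh; have [B1 [_ B2]] := H h s (lexx _) sh.
have [s1 s1h E1] := @mean_value_line _ f x v h
   (fun s sh => Ck_on_derivable fA (Hv s sh).1 v).
have [s2 s2h E2] := @mean_value_line _ f (x + h *: v) w h
   (fun s sh => Ck_on_derivable fA (Hw s sh).1 w).
have -> : f (x + h *: (v + w)) - f x - h *: ('D_v f x + 'D_w f x) =
   - (h * ('D_w f x - 'D_w f (x + h *: v + s2 *: w))) - h * ('D_v f x - 'D_v f (x + s1 *: v)).
  rewrite scalerDr addrA.
  rewrite -[f _ - f x](subrKA (f (x + h *: v))) E1 E2 /GRing.scale /=; ring.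
apply: le_trans (ler_normB _ _) _; rewrite normrN !normrM.
have -> : e * `|h| = `|h| * (e / 2) + `|h| * (e / 2) by field.
by apply: lerD; rewrite ler_wpM2l//; [case: (Hw s2 s2h) | case: (Hv s1 s1h)].
Qed.

Lemma derive_C1_scale (V W : normedModType R) (f : V -> W) x v (a : R) :
  derivable f x v -> 'D_(a *: v) f x = a *: 'D_v f x.
Proof. by move=> df; have [_ ->] := is_derive_scale a (derivableP df). Qed.

Lemma derive_C1_add (V : normedModType R) (A : set V) (f : V -> R^o) x v w :
  open A -> Ck_on 1 A f -> A x -> 'D_(v + w) f x = 'D_v f x + 'D_w f x.
Proof. by move=> oA fA Ax; have [_ ->] := is_derive_C1_add v w oA fA Ax. Qed.

Lemma derive_C1_sum (V : normedModType R) (A : set V) (f : V -> R^o) x m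
    (a : 'I_m -> R) (v : 'I_m -> V) :
  open A -> Ck_on 1 A f -> A x ->
  'D_(\sum_i a i *: v i) f x = \sum_i a i * 'D_(v i) f x.
Proof.
move=> oA fA Ax; elim: m a v => [|m IHm] a v; first by rewrite !big_ord0 derive0.
rewrite !big_ord_recr /= (derive_C1_add _ _ oA fA Ax) IHm derive_C1_scale//.
exact: (Ck_on_derivable fA Ax).
Qed.

Section LinearChange.
Context {P Q : normedModType R} (L : P -> Q).
Hypotheses (linL : linear L) (cL : continuous L).

Lemma derive_comp_linear (W : normedModType R) (f : Q -> W) p v :
  (derivable f (L p) (L v) -> derivable (f \o L) p v) /\
  'D_v (f \o L) p = 'D_(L v) f (L p).
Proof.
have E : (fun h : R => h^-1 *: (((f \o L) \o shift p) (h *: v) - (f \o L) p)) =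
   (fun h => h^-1 *: ((f \o shift (L p)) (h *: L v) - f (L p))).
  by apply/funext => h /=; rewrite linL.
by rewrite /derivable /derive E.
Qed.

(** The derivative of f \o L along v is the derivative of f along L v, composed with L: the shape is
    preserved and the induction on k closes. *)
Lemma Ck_on_comp_linear (W : normedModType R) k (A : set P) (B : set Q) (f : Q -> W) :
  open A -> (forall p, A p -> B (L p)) -> Ck_on k B f -> Ck_on k A (f \o L).
Proof.
move=> oA AB; elim: k f => [|k IHk] f fB.
  split=> // p Ap; apply: continuous_comp; first exact: cL.
  exact: Ck_on_continuous fB (AB _ Ap).
split=> [p Ap|v].
  apply: continuous_comp; first exact: cL.
  exact: Ck_on_continuous fB (AB _ Ap).
split=> [p Ap|].
  apply: (derive_comp_linear f p v).1.
  exact: (Ck_on_derivable fB (AB _ Ap)).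
apply: (@Ck_on_eq _ _ _ _ ('D_(L v) f \o L)) => //.
  by move=> p Ap; rewrite (derive_comp_linear f p v).2.
by apply: IHk; exact: Ck_on_derive.
Qed.

End LinearChange.

Lemma is_derive_linear (P Q : normedModType R) (L : P -> Q) p v :
  linear L -> is_derive p v L (L v).
Proof.
move=> linL; apply/is_derive_epsP => e e0; near=> h.
rewrite [p + _]addrC linL addrK subrr normr0 mulr_ge0// ltW//.
Unshelve. all: by end_near. Qed.

(** A linear factor has constant derivative l v, so differentiating yields a product of the same
    kind plus a multiple of f. *)
Lemma Ck_on_mul_linear (P : normedModType R) k (A : set P) (l f : P -> R^o) :
  open A -> linear l -> continuous l -> Ck_on k A f -> Ck_on k A (l * f).
Proof.
move=> oA linl cl; elim: k f => [|k IHk] f fA.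
  split=> // p Ap; apply: cvgM; first exact: cl.
  exact: Ck_on_continuous fA Ap.
split=> [p Ap|v].
  apply: cvgM; first exact: cl.
  exact: Ck_on_continuous fA Ap.
have df p (Ap : A p) := Ck_on_derivable fA Ap v.
have dl p : derivable l p v by have [] := is_derive_linear p v linl.
split=> [p Ap|]; first by apply: derivableM => //; exact: df.
apply: (@Ck_on_eq _ _ _ _ (fun p => (l * 'D_v f) p + l v *: f p)) => //.
  move=> p Ap; rewrite deriveM//; last exact: df.
  have [_ ->] := is_derive_linear p v linl.
  by rewrite [_ *: l v]mulrC.
apply: Ck_on_add => //; first by apply: IHk; exact: Ck_on_derive.
by apply: Ck_on_scale => //; exact: Ck_onW.
Qed.

End CkCalculus.

(** * Integrals depending on a parameter and smoothness *)

Section ParameterIntegral.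
Context {R : realType} {P Q : normedModType R}.
Local Notation mu := (@lebesgue_measure R).

Let le_norm_sub2 (x y z K : R) : x <= y + z + K -> y + z <= x + K -> `|x - y - z| <= K.
Proof. by move=> h1 h2; rewrite ler_norml; apply/andP; split; lra. Qed.

(** Tube lemma: compactness of [0, 1] makes continuity in the parameter uniform in t. *)
Lemma unit_interval_tube (G : P -> R -> R) p0 (e : R) :
  (forall t, 0 <= t <= 1 -> {for (p0, t), continuous (fun q : P * R => G q.1 q.2)}) ->
  0 < e ->
  \forall p \near p0, forall t, 0 <= t <= 1 -> `|G p t - G p0 t| <= e.
Proof.
move=> cG e0; have e2 : 0 < e / 2 by rewrite divr_gt0.
have H (t : R) : `[0, 1]%classic t ->
    \forall t' \near t & p \near p0, `|G p t' - G p0 t'| <= e.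
  rewrite /= in_itv /= => t01.
  have /cvgrPdist_le/(_ _ e2) := cG t t01; move=> -[[A B] /= [nA nB] AB].
  exists (B, A) => //= -[t' p] /= [Bt' Ap].
  have H1 := AB (p, t') (conj Ap Bt').
  have H2 := AB (p0, t') (conj (nbhs_singleton nA) Bt').
  rewrite /= in H1 H2.
  have -> : G p t' - G p0 t' = (G p0 t - G p0 t') - (G p0 t - G p t') by ring.
  have -> : e = e / 2 + e / 2 by field.
  by apply: le_trans (ler_normB _ _) _; exact: lerD.
have nc := (compact_near_coveringP _).1 (@segment_compact R 0 1).
have Hn : \forall p \near p0, `[0, 1]%classic `<=` (fun t => `|G p t - G p0 t| <= e).
  exact: (nc P (nbhs p0) (fun p t => `|G p t - G p0 t| <= e) _ H).
apply: filterS Hn => p Hp t t01.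
by apply: (Hp t); rewrite /= in_itv.
Qed.

Variables (L0 L1 : P -> Q) (A : set P) (B : set Q).
Hypotheses (linL0 : linear L0) (linL1 : linear L1)
  (cL0 : continuous L0) (cL1 : continuous L1) (oA : open A) (oB : open B).
Hypothesis AB : forall p t, A p -> 0 <= t <= 1 -> B (L0 p + t *: L1 p).

Lemma line_family_continuous (K : Q -> R^o) p (t : R) : B (L0 p + t *: L1 p) ->
  (forall q, B q -> {for q, continuous K}) ->
  {for (p, t), continuous (fun q : P * R => K (L0 q.1 + q.2 *: L1 q.1))}.
Proof.
move=> Bq cK.
apply: (@continuous_comp _ _ _ (fun q : P * R => L0 q.1 + q.2 *: L1 q.1) K); last exact: cK.
have c1 : {for (p, t), continuous (fun q : P * R => q.1)} by exact: cvg_fst.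
have c2 : {for (p, t), continuous (fun q : P * R => q.2)} by exact: cvg_snd.
apply: cvgD.
  by apply: (@continuous_comp _ _ _ (fun q : P * R => q.1) L0); [exact: c1|exact: cL0].
apply: cvgZ; first exact: c2.
by apply: (@continuous_comp _ _ _ (fun q : P * R => q.1) L1); [exact: c1|exact: cL1].
Qed.

Lemma line_continuous (K : Q -> R^o) p (t : R) : A p -> 0 <= t <= 1 ->
  (forall q, B q -> {for q, continuous K}) ->
  {for t, continuous (fun t : R => K (L0 p + t *: L1 p))}.
Proof.
move=> Ap t01 cK.
have c : (L0 p + u *: L1 p) @[u --> t] --> L0 p + t *: L1 p.
  apply: cvgD; first exact: cvg_cst.
  exact: scalel_continuous.
apply: (@continuous_comp _ _ _ (fun t : R => L0 p + t *: L1 p) K); first exact: c.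
by apply: cK; exact: AB.
Qed.

Let weighted_continuous (K : Q -> R^o) m p (t : R) : A p -> 0 <= t <= 1 ->
  (forall q, B q -> {for q, continuous K}) ->
  {for t, continuous (fun t : R => t ^+ m * K (L0 p + t *: L1 p))}.
Proof.
move=> Ap t01 cK; apply: cvgM; first exact: exprn_continuous.
exact: line_continuous.
Qed.

Let weight_le1 m (t : R) : 0 <= t <= 1 -> 0 <= t ^+ m <= 1.
Proof. by move=> /andP[t0 t1]; rewrite exprn_ge0//= exprn_ile1. Qed.

(** Differentiating in p along v produces D_(L0 v) K + t D_(L1 v) K under the integral. The weight t
    ^+ m makes the family closed under differentiation. *)
Definition line_integral m (K : Q -> R^o) (p : P) : R^o :=
  \int[mu]_(t in `[0, 1]) (t ^+ m * K (L0 p + t *: L1 p)).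

Lemma line_integral_continuous m (K : Q -> R^o) p : A p ->
  (forall q, B q -> {for q, continuous K}) -> {for p, continuous (line_integral m K)}.
Proof.
move=> Ap cK; apply/cvgrPdist_le => e e0.
have nA : \forall p' \near p, A p' by exact: open_nbhs_nbhs.
have cG t : 0 <= t <= 1 ->
    {for (p, t), continuous (fun q : P * R => K (L0 q.1 + q.2 *: L1 q.1))}.
  by move=> t01; apply: line_family_continuous => //; exact: AB.
have tube := unit_interval_tube (G := fun p t => K (L0 p + t *: L1 p)) cG e0.
near=> p'.
have Ap' : A p' by near: p'.
have H : forall t, 0 <= t <= 1 -> `|K (L0 p' + t *: L1 p') - K (L0 p + t *: L1 p)| <= e.
  by near: p'.
have wc := weighted_continuous.
rewrite ler_distl lerBlDr; apply/andP; split; apply: integral01_leD => t t01;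
  try by apply: wc.
  have /andP[w0 w1] := weight_le1 m t01.
  have h : t ^+ m * (K (L0 p' + t *: L1 p') - K (L0 p + t *: L1 p)) <= e.
    apply: le_trans (ler_norm _) _; rewrite normrM (ger0_norm w0) -[leRHS]mul1r.
    by apply: ler_pM => //; exact: H.
  by rewrite mulrBr in h; lra.
have /andP[w0 w1] := weight_le1 m t01.
have h : t ^+ m * (K (L0 p + t *: L1 p) - K (L0 p' + t *: L1 p')) <= e.
  apply: le_trans (ler_norm _) _; rewrite normrM (ger0_norm w0) -[leRHS]mul1r.
  by apply: ler_pM => //; rewrite distrC; exact: H.
by rewrite mulrBr in h; lra.
Unshelve. all: by end_near. Qed.

(** For each t, the mean value theorem along L0 v + t L1 v; the intermediate point depends on t, and
    the tube lemma bounds the oscillation of both derivatives by e / 2 uniformly in t. *)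
Lemma line_integral_derive m (H : Q -> R^o) p v : Ck_on 1 B H -> A p ->
  is_derive p v (line_integral m H)
    (line_integral m ('D_(L0 v) H) p + line_integral m.+1 ('D_(L1 v) H) p).
Proof.
move=> HB Ap; apply/is_derive_epsP => e e0.
have e2 : 0 < e / 2 by rewrite divr_gt0.
pose K0 := 'D_(L0 v) H; pose K1 := 'D_(L1 v) H.
have cH q : B q -> {for q, continuous H} by move=> Bq; exact: (Ck_on_continuous HB Bq).
have cK0 q : B q -> {for q, continuous K0}.
  by move=> Bq; exact: (Ck_on_continuous (Ck_on_derive HB _) Bq).
have cK1 q : B q -> {for q, continuous K1}.
  by move=> Bq; exact: (Ck_on_continuous (Ck_on_derive HB _) Bq).
have nA : \forall p' \near p, A p' by exact: open_nbhs_nbhs.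
have tube (K : Q -> R^o) : (forall q, B q -> {for q, continuous K}) ->
    \forall p' \near p, forall t, 0 <= t <= 1 ->
      `|K (L0 p' + t *: L1 p') - K (L0 p + t *: L1 p)| <= e / 2.
  move=> cK; apply: (unit_interval_tube (G := fun p t => K (L0 p + t *: L1 p))) => // t t01.
  by apply: line_family_continuous => //; exact: AB.
apply: filterS (near_line v 0 (filterI nA (filterI (tube K0 cK0) (tube K1 cK1)))) => h Hh.
have {}Hh s : `|s| <= `|h| -> [/\ A (p + s *: v),
    forall t, 0 <= t <= 1 -> `|K0 (L0 (p + s *: v) + t *: L1 (p + s *: v)) -
       K0 (L0 p + t *: L1 p)| <= e / 2 &
    forall t, 0 <= t <= 1 -> `|K1 (L0 (p + s *: v) + t *: L1 (p + s *: v)) -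
       K1 (L0 p + t *: L1 p)| <= e / 2].
  move=> sh; have [|B1 [B2 B3]] := Hh s 0 sh; first by rewrite normr0.
  by move: B1 B2 B3; rewrite scale0r addr0.
have lineD (s t : R) : L0 (p + s *: v) + t *: L1 (p + s *: v) =
    (L0 p + t *: L1 p) + s *: (L0 v + t *: L1 v).
  rewrite [p + _]addrC linL0 linL1 !scalerDr !scalerA [t * s]mulrC -!scalerA.
  by rewrite addrACA [RHS]addrC addrACA [s *: L0 v + _]addrC addrC.
have main t : 0 <= t <= 1 ->
    `|H (L0 (p + h *: v) + t *: L1 (p + h *: v)) - H (L0 p + t *: L1 p) -
      h * (K0 (L0 p + t *: L1 p) + t * K1 (L0 p + t *: L1 p))| <= e * `|h|.
  move=> t01; have [|s sh] := @mean_value_line _ _ H (L0 p + t *: L1 p) (L0 v + t *: L1 v) h.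
    move=> s sh; rewrite -lineD; have [As _ _] := Hh s sh.
    by apply: (Ck_on_derivable HB); exact: AB.
  rewrite -!lineD => ->; have [As H0 H1] := Hh s sh.
  have Bs := AB As t01.
  rewrite (derive_C1_add _ _ oB HB Bs) derive_C1_scale; last exact: (Ck_on_derivable HB Bs).
  rewrite -/K0 -/K1; set q := L0 p + t *: L1 p in H0 H1 *.
  set qs := L0 (p + s *: v) + t *: L1 (p + s *: v) in H0 H1 *.
  have -> : h * (K0 qs + t *: K1 qs) - h * (K0 q + t * K1 q) =
      h * ((K0 qs - K0 q) + t * (K1 qs - K1 q)) by rewrite /GRing.scale /=; ring.
  rewrite normrM mulrC ler_wpM2r//; apply: le_trans (ler_normD _ _) _.
  have -> : e = e / 2 + 1 * (e / 2) by field.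
  apply: lerD; first exact: H0.
  have /andP[t0 t1] := t01; rewrite normrM (ger0_norm t0).
  by apply: ler_pM => //; exact: H1.
have [Ah _ _] := Hh h (lexx _).
pose f (t : R) : R := t ^+ m * H (L0 (p + h *: v) + t *: L1 (p + h *: v)).
pose g1 (t : R) : R := t ^+ m * H (L0 p + t *: L1 p).
pose g2 (t : R) : R := t ^+ m * K0 (L0 p + t *: L1 p).
pose g3 (t : R) : R := t ^+ m.+1 * K1 (L0 p + t *: L1 p).
have cf t : 0 <= t <= 1 -> {for t, continuous f}.
  by move=> t01; exact: (@weighted_continuous H m (p + h *: v) t Ah t01 cH).
have cg1 t : 0 <= t <= 1 -> {for t, continuous g1}.
  by move=> t01; exact: (@weighted_continuous H m p t Ap t01 cH).
have cg2 t : 0 <= t <= 1 -> {for t, continuous g2}.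
  by move=> t01; exact: (@weighted_continuous K0 m p t Ap t01 cK0).
have cg3 t : 0 <= t <= 1 -> {for t, continuous g3}.
  by move=> t01; exact: (@weighted_continuous K1 m.+1 p t Ap t01 cK1).
pose g23 t := g2 t + g3 t; pose hg t := h * g23 t; pose g t := g1 t + hg t.
have cg23 t : 0 <= t <= 1 -> {for t, continuous g23}.
  by move=> t01; apply: cvgD; [exact: cg2 | exact: cg3].
have chg t : 0 <= t <= 1 -> {for t, continuous hg}.
  by move=> t01; apply: cvgM; [exact: cvg_cst | exact: cg23].
have cg t : 0 <= t <= 1 -> {for t, continuous g}.
  by move=> t01; apply: cvgD; [exact: cg1 | exact: chg].
have gE : \int[mu]_(t in `[0, 1]) g t = \int[mu]_(t in `[0, 1]) g1 t +
    h * (\int[mu]_(t in `[0, 1]) g2 t + \int[mu]_(t in `[0, 1]) g3 t).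
  rewrite RintegralD//; [|exact: continuous_itv_integrable..]; congr (_ + _).
  rewrite RintegralZl//; last exact: continuous_itv_integrable.
  have i2 := continuous_itv_integrable cg2; have i3 := continuous_itv_integrable cg3.
  congr (_ * _); have := RintegralD _ i2 i3; exact.
have fg t : 0 <= t <= 1 -> `|f t - g t| <= e * `|h|.
  move=> t01; have /andP[w0 w1] := weight_le1 m t01.
  have -> : f t - g t = t ^+ m *
      (H (L0 (p + h *: v) + t *: L1 (p + h *: v)) - H (L0 p + t *: L1 p) -
      h * (K0 (L0 p + t *: L1 p) + t * K1 (L0 p + t *: L1 p))).
    by rewrite /g /hg /g23 /f /g1 /g2 /g3 exprS; ring.
  rewrite normrM (ger0_norm w0) -[leRHS]mul1r.
  by apply: ler_pM => //; exact: main.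
have up : \int[mu]_(t in `[0, 1]) f t <= \int[mu]_(t in `[0, 1]) g t + e * `|h|.
  apply: integral01_leD => // t t01; rewrite -lerBlDl.
  exact: le_trans (ler_norm _) (fg t t01).
have lo : \int[mu]_(t in `[0, 1]) g t <= \int[mu]_(t in `[0, 1]) f t + e * `|h|.
  apply: integral01_leD => // t t01; rewrite -lerBlDl.
  by apply: le_trans (ler_norm _) _; rewrite distrC; exact: fg.
rewrite gE in up lo.
change (`|\int[mu]_(t in `[0, 1]) f t - \int[mu]_(t in `[0, 1]) g1 t -
  h * (\int[mu]_(t in `[0, 1]) g2 t + \int[mu]_(t in `[0, 1]) g3 t)| <= e * `|h|).
exact: (le_norm_sub2 up lo).
Qed.

(** The induction varies [m] and [H], because a derivative is a sum of two such integrals with other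
    weights and integrands. *)
Lemma Ck_on_line_integral k m (H : Q -> R^o) :
  Ck_on k B H -> Ck_on k A (line_integral m H).
Proof.
elim: k m H => [|k IHk] m H HB.
  split=> // p Ap; apply: line_integral_continuous => // q Bq.
  exact: (Ck_on_continuous HB Bq).
have HB1 : Ck_on 1 B H.
  split=> [q Bq|v]; first exact: (Ck_on_continuous HB Bq).
  split=> [q Bq|]; first exact: (Ck_on_derivable HB Bq).
  by split=> // q Bq; exact: (Ck_on_continuous (Ck_on_derive HB v) Bq).
split=> [p Ap|v].
  apply: line_integral_continuous => // q Bq; exact: (Ck_on_continuous HB Bq).
have dI p (Ap : A p) := line_integral_derive m v HB1 Ap.
split=> [p Ap|]; first by case: (dI p Ap).
apply: (@Ck_on_eq _ _ _ _ _ (fun p => line_integral m ('D_(L0 v) H) p +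
    line_integral m.+1 ('D_(L1 v) H) p)) => //.
  by move=> p Ap; have [_ ->] := dI p Ap.
by apply: Ck_on_add => //; apply: IHk; exact: Ck_on_derive.
Qed.

End ParameterIntegral.

Lemma continuous_pair (T U W : topologicalType) (f : T -> U) (g : T -> W) :
  continuous f -> continuous g -> continuous (fun t => (f t, g t)).
Proof. by move=> cf cg x; exact: (cvg_pair (cf x) (cg x)). Qed.

(** * Smoothness of the metric and of the pseudo-norm function *)

Section Smoothness.
Context {R : realType} {n : nat}.
Local Notation V := 'rV[R]_n.
Variables (Omega : set V) (d F : V -> V -> R).
Hypotheses (cO : convex_domain Omega) (md : asymmetric_metric Omega d)
  (fd : projectively_flat Omega d) (pF : pseudo_norm_function Omega F)
  (tF : tangent_function Omega d F) (bd : locally_bounded_by_norm Omega d).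

Let oO : open Omega. Proof. by case: cO. Qed.

Lemma open_neq (U : normedModType R) (T : topologicalType) (f g : T -> U) :
  continuous f -> continuous g -> open [set p | f p <> g p].
Proof.
move=> cf cg.
have -> : [set p | f p <> g p] = (fun p => f p - g p) @^-1` [set u | u <> 0].
  apply/seteqP; split=> p /= pn H; apply: pn; last by rewrite H subrr.
  by apply/eqP; rewrite -subr_eq0 H.
apply: open_comp; first by move=> p _; apply: cvgB; [exact: cf | exact: cg].
have -> : [set u : U | u <> 0] = ~` [set 0] by [].
apply: closed_openC; apply: accessible_closed_set1.
by apply: hausdorff_accessible; exact: norm_hausdorff.
Qed.

Let fst_continuous : continuous (fun p : V * V => p.1).
Proof. by move=> p; exact: cvg_fst. Qed.

Let snd_continuous : continuous (fun p : V * V => p.2).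
Proof. by move=> p; exact: cvg_snd. Qed.

Lemma open_off_diagonal : open [set p : V * V | [/\ Omega p.1, Omega p.2 & p.1 <> p.2]].
Proof.
have -> : [set p : V * V | [/\ Omega p.1, Omega p.2 & p.1 <> p.2]] =
    (Omega `*` Omega) `&` [set p | p.1 <> p.2].
  by apply/seteqP; split=> p /= => [[? ? ?]|[[? ?] ?]]; split.
by apply: openI; [exact: open_setX | exact: open_neq].
Qed.

Lemma open_nonzero_vectors : open [set p : V * V | Omega p.1 /\ p.2 <> 0].
Proof.
have -> : [set p : V * V | Omega p.1 /\ p.2 <> 0] = Omega `*` [set v | v <> 0] by [].
apply: open_setX => //.
apply: (@open_neq V V id (cst 0)); last exact: cst_continuous.
by move=> x; exact: cvg_id.
Qed.

Lemma smooth_pseudo_norm_function_metric :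
  smooth_pseudo_norm_function Omega F -> smooth_metric Omega d.
Proof.
(* For p = (x1, x2), L0 p + t L1 p is the point (x1 + t (x2 - x1), x2 - x1) of the tangent bundle;
   off the diagonal it avoids the zero section. *)
move=> sF k; pose L0 (p : V * V) : V * V := (p.1, p.2 - p.1).
pose L1 (p : V * V) : V * V := (p.2 - p.1, 0).
have linL0 : linear L0.
  by move=> a u v; apply: injective_projections => //=;
    apply/matrixP => i j; rewrite !mxE; ring.
have linL1 : linear L1.
  by move=> a u v; apply: injective_projections => //=;
    apply/matrixP => i j; rewrite !mxE; ring.
have cB : continuous (fun p : V * V => p.2 - p.1).
  by move=> p; apply: cvgB; [exact: snd_continuous | exact: fst_continuous].
have cL0 : continuous L0 := continuous_pair fst_continuous cB.
have cL1 : continuous L1.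
  by apply: continuous_pair; [exact: cB | exact: cst_continuous].
have AB p t : [/\ Omega p.1, Omega p.2 & p.1 <> p.2] -> 0 <= t <= 1 ->
    [set p | Omega p.1 /\ p.2 <> 0] (L0 p + t *: L1 p).
  move=> [p1 p2 p12] t01; split=> /=; first exact: (convex_segment cO p1 p2 t01).
  rewrite scaler0 addr0 => /eqP; rewrite subr_eq0 => /eqP p21.
  by apply: p12; rewrite p21.
have := Ck_on_line_integral linL0 linL1 cL0 cL1 open_off_diagonal open_nonzero_vectors AB 0 (sF k).
apply: Ck_on_eq; first exact: open_off_diagonal.
move=> [x1 x2] /= [u1 u2 _].
rewrite (metric_segment_integral cO md fd pF tF bd u1 u2) /line_integral.
by apply: eq_Rintegral => t _ /=; rewrite expr0 mul1r scaler0 addr0.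
Qed.

(** By additivity, the increment of d (x - e y) from x to x + h y is d x (x + h y), whose right
    derivative is F x y. Derivability identifies the two-sided derivative with this one. *)
Lemma derive_metric_tangent x y (e : R) : 0 < e -> Omega x -> Omega (x - e *: y) ->
  derivable (fun p : V * V => d p.1 p.2 : R^o) (x - e *: y, x) (0, y) ->
  'D_(0, y) (fun p : V * V => d p.1 p.2 : R^o) (x - e *: y, x) = F x y.
Proof.
move=> e0 Ox Oxe /derivableP; set D := 'D_(0, y) _ _ => dD.
apply/eqP; rewrite -subr_eq0 -normr_le0; apply/ler_addgt0Pl => r r0; rewrite addr0.
have r2 : 0 < r / 2 by rewrite divr_gt0.
have /is_derive_epsP/(_ _ r2)/near_at_right dr := dD.
have := tF y Ox r2 => tr.
have nO : \forall z \near x, Omega z by exact: open_nbhs_nbhs.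
have /near_at_right nl := near_line y 0 nO.
near (0 : R)^'+ => h.
have h0 : 0 < h by near: h; exact: nbhs_right_gt.
have Oh : Omega (x + h *: y).
  have H : forall s r, `|s| <= `|h| -> `|r| <= `|h| -> Omega (x + s *: y + r *: 0).
    by near: h.
  by have := H h 0 (lexx _); rewrite normr0 scale0r addr0; apply.
have H1 : `|d (x - e *: y + h *: 0) (x + h *: y) - d (x - e *: y) x - h * D| <= r / 2 * `|h|.
  by near: h.
have H2 : `|d x (x + h *: y) - h * F x y| <= r / 2 * h by near: h.
have xE : x - e *: y + e *: y = x by rewrite subrK.
have xhE : x - e *: y + (e + h) *: y = x + h *: y by rewrite scalerDl addrA subrK.
have := projectively_flat_add (x := x - e *: y) (v := y) cO md fd Oxe _ (ltW e0) (ltW h0).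
rewrite xE xhE => /(_ Oh) ADD.
move: H1; rewrite scaler0 addr0 ADD (gtr0_norm h0) => H1.
rewrite -(ler_pM2l h0) -{1}(gtr0_norm h0) -normrM.
move: H1 H2; move: (d x (x + h *: y)) (d (x - e *: y) x) (F x y) => a b c.
rewrite !ler_norml => /andP[H1 H2] /andP[H3 H4]; apply/andP; split; lra.
Unshelve. all: by end_near. Qed.

Lemma smooth_metric_pseudo_norm_function :
  smooth_metric Omega d -> smooth_pseudo_norm_function Omega F.
Proof.
move=> sd k; apply: Ck_on_local => -[x0 y0] /= [Ox0 y00].
have nO : \forall z \near x0, Omega z by exact: open_nbhs_nbhs.
have /near_at_right nl := near_line y0 0 nO.
(* How far one can step back inside Omega depends on the point; this [e] is then kept fixed on the
   open set [B] around (x0, y0). *)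
have [e e0 Oe] : exists2 e : R, 0 < e & Omega (x0 - e *: y0).
  near (0 : R)^'+ => h; have h0 : 0 < h by near: h; exact: nbhs_right_gt.
  exists h => //.
  have H : forall s r, `|s| <= `|h| -> `|r| <= `|h| -> Omega (x0 + s *: y0 + r *: 0).
    by near: h.
  by have := H (- h) 0; rewrite normrN normr0 scale0r addr0 scaleNr; apply.
pose L (p : V * V) : V * V := (p.1 - e *: p.2, p.1).
pose d' : V * V -> R^o := fun p => d p.1 p.2.
have linL : linear L.
  by move=> a u v; apply: injective_projections => //=;
    apply/matrixP => i j; rewrite !mxE; ring.
have cL1 : continuous (fun p : V * V => p.1 - e *: p.2).
  move=> p; apply: cvgB; first exact: fst_continuous.
  by apply: cvgZ; [exact: cvg_cst | exact: snd_continuous].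
have cL : continuous L := continuous_pair cL1 fst_continuous.
pose B := [set p : V * V | Omega p.1 /\ p.2 <> 0] `&` [set p | Omega (p.1 - e *: p.2)].
have oB : open B.
  apply: openI; first exact: open_nonzero_vectors.
  by apply: (@open_comp _ _ (fun p : V * V => p.1 - e *: p.2)) => // p _; exact: cL1.
have BL p : B p -> [/\ Omega (L p).1, Omega (L p).2 & (L p).1 <> (L p).2].
  move=> [[p1 p2] p3]; split=> //= /eqP; rewrite -subr_eq0 addrC addKr oppr_eq0.
  by rewrite scaler_eq0 (gt_eqF e0) => /eqP.
exists B; first by split.
(* The direction (0, y) moves with the point, while [Ck_on] speaks of fixed directions. Expanding y
   in coordinates leaves fixed directions with linear coefficients. *)
have FE p : B p -> \sum_(j < n) (p.2 0 j * 'D_(0, delta_mx 0 j) d' (L p)) = F p.1 p.2.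
  move=> Bp; rewrite -(derive_C1_sum _ _ open_off_diagonal (sd 1%N) (BL p Bp)).
  have -> : \sum_(j < n) p.2 0 j *: ((0, delta_mx 0 j) : V * V) = (0, p.2).
    rewrite [in RHS](row_sum_delta p.2).
    apply: (big_rec2 (fun w u => w = (0 : V, u))) => // j w u _ ->.
    by apply: injective_projections => /=; rewrite ?scaler0 ?addr0.
  have [[p1 _] p2] := Bp.
  apply: derive_metric_tangent => //.
  exact: (Ck_on_derivable (sd 1%N) (BL p Bp)).
apply: Ck_on_eq FE _ => //.
apply: Ck_on_sum => // j.
apply: (@Ck_on_mul_linear _ _ _ _ (fun p : V * V => p.2 0 j) ('D_(0, delta_mx 0 j) d' \o L)) => //.
- by move=> a u v; rewrite /= !mxE.
- move=> p; apply: (@continuous_comp _ _ _ (fun q : V * V => q.2) (fun v : V => v 0 j)).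
    exact: snd_continuous.
  exact: coord_continuous.
by apply: (Ck_on_comp_linear linL cL oB BL); apply: Ck_on_derive; exact: (sd k.+1).
Unshelve. all: by end_near. Qed.

End Smoothness.

(** The two metrics agree only on Omega, and by convexity the length of a segment evaluates them
    only there. *)
Lemma projectively_flat_induced {R : realType} {n : nat} (Omega : set 'rV[R]_n)
    (d d' : 'rV[R]_n -> 'rV[R]_n -> R) :
  convex_domain Omega -> projectively_flat Omega d ->
  (forall x1 x2, Omega x1 -> Omega x2 -> d x1 x2 = d' x1 x2) ->
  projectively_flat Omega d'.
Proof.
move=> cO fd dd' x1 x2 Ox1 Ox2; rewrite -dd'// fd//; congr ereal_sup.
apply: eq_imagel => s /= ps; congr EFin; apply: eq_bigr => i _.
have Os j : (j < (size s).+1)%N -> Omega (segment x1 x2 (nth 1 (0 :: s) j)).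
  move=> js; apply: convex_segment => //.
  by rewrite (itv_partition_nth_ge js ps) (itv_partition_nth_le js ps).
by apply: dd'; [apply: (Os i) | apply: (Os i.+1)]; rewrite ltnS// ltnW.
Qed.

Theorem theorem7p1 (R : realType) (n : nat) (Omega : set 'rV[R]_n)
    (d : 'rV[R]_n -> 'rV[R]_n -> R)
    (hOmega : convex_domain Omega)
    (hd : asymmetric_metric Omega d)
    (hflat : projectively_flat Omega d) :
  ((exists F : 'rV[R]_n -> 'rV[R]_n -> R,
      [/\ pseudo_norm_function Omega F,
          lipschitz_pseudo_norm_function Omega F
        & induced_by Omega d F])
   <-> locally_euclidean_bounds Omega d) /\
  (forall F : 'rV[R]_n -> 'rV[R]_n -> R,
     pseudo_norm_function Omega F ->
     lipschitz_pseudo_norm_function Omega F ->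
     induced_by Omega d F ->
     projectively_flat Omega (induced_metric Omega F) /\
     (smooth_metric Omega d <-> smooth_pseudo_norm_function Omega F)).
Proof.
split.
  split=> [[F [pF lF iF]]|/locally_euclidean_boundsP hb].
    apply/locally_euclidean_boundsP => x Ox.
    exact: (induced_local_bounds hOmega pF lF iF hd hflat Ox).
  exists (dyadic_derivative d); split.
  - exact: (dyadic_derivative_pseudo_norm_function hOmega hd hflat hb).
  - exact: (dyadic_derivative_lipschitz_function hOmega hd hflat hb).
  - exact: (dyadic_derivative_induced hOmega hd hflat hb).
move=> F pF lF iF; split; first exact: projectively_flat_induced hflat iF.
have tF := induced_tangent hOmega pF lF iF.
have bd := induced_bounded hOmega pF lF iF.
split=> H.
  exact: (smooth_metric_pseudo_norm_function hOmega hd hflat tF H).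
exact: (smooth_pseudo_norm_function_metric hOmega hd hflat pF tF bd H).
Qed.
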